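(* Every legal history $H$ generated by the SF-SVOSTM algorithm is conflict-opaque (co-opaque).
   Context: **Model.** Threads execute transactions $T_i$ on a shared hash table of keys. A transaction invokes the methods STM_begin, STM_lookup$(k)$, STM_delete$(k)$, STM_insert$(k,v)$, STM_tryC, STM_tryA. Return-value methods (rv-methods) are lookup and delete; they return the value of the key (possibly nil) or abort. Update methods are insert and delete; their effect on shared memory takes place at a successful tryC. A transaction ends by returning commit or abort and then invokes nothing else; a transaction that has done neither is live. A history $H$ is a totally ordered set of events of transactions, well-formed (a transaction invokes a method only after the previous one responded). Methods are treated as atomic, ordered by their linearization points (the first unlocking point of each successful method); $m\prec_H^{MR}m'$ means $m$ responds before $m'$ is invoked. An initial transaction $T_0$ commits before all others, all keys having value nil. $\overline H$ is the completion of $H$: abort is inserted immediately for every live transaction, except that a transaction whose tryC has successfully executed its first operation is made to commit. Histories are equivalent if they have the same events. $T_i\prec_H^{TR}T_j$ means $T_i$ terminates before $T_j$ begins. $S$ is serial (t-sequential) if all its transactions are terminated and any two are ordered by $\prec_S^{TR}$. A history is legal if every rv-method on a key $k$ returns the value from the closest previous committed transaction that updated $k$. **Conflicts.** Distinct $T_i,T_j$ conflict, $T_i\prec_H^{Conf}T_j$, if one of: (tryC-tryC) both are committed, both update the same key, and tryC$_i\prec_H^{MR}$ tryC$_j$; (tryC-rv) $T_i$ updated $k$ and committed, and afterwards an rv-method of $T_j$ on $k$ returns the value updated by $T_i$; (rv-tryC) an rv-method of $T_i$ on $k$ returns a value updated by a committed transaction, and afterwards $T_j$, which updates $k$, commits.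 **Co-opacity.** $H$ is co-opaque if there is a serial history $S$ with: (1) $S$ equivalent to $\overline H$; (2) $S$ legal; (3) $\prec_H^{TR}\subseteq\prec_S^{TR}$; (4) $\prec_H^{Conf}\subseteq\prec_S^{Conf}$. **Algorithm SF-SVOSTM.** Shared memory is a hash table with $M$ buckets, each a list sorted by key between two sentinels; a node has fields key, value, lock, mark (true = logically deleted), rvl (a list of transaction timestamps), and two links: red links reach all nodes, blue links only unmarked nodes. ''Locating $k$'' means finding, without locks, predecessor and current nodes of $k$ along the blue links and along the red links; then these nodes are locked in increasing key order and validated (rv_Validation: blue predecessor and blue current are unmarked, blue predecessor's blue link points to blue current, red predecessor's red link points to red current); if validation fails, release locks and retry. A global atomic counter gcounter is used. Each $T_i$ has a local log, timestamps $its_i,cts_i$ (the identifier $i$ is $cts_i$), and a status in {live, commit, false}. - *STM_begin(its)*: if this is the first incarnation, $its_i=cts_i=$ gcounter.get&Inc(); otherwise (retry of an aborted transaction) $its_i=its$ (that of the first incarnation) and $cts_i=$ gcounter.get&Inc(). Set status$_i$ = live. - *rv-method on $k$*: if $k$ is in the local log, update the log and answer from it. Otherwise, if status$_i$ = false, abort. Otherwise locate, lock and validate. If no node for $k$ exists, create a marked node for $k$ with rvl $=\{i\}$, reachable only by red links, release locks, log $k$, return nil. If it exists, add $i$ to its rvl, release locks, log $k$ and the value, return the value. - *insert*: recorded in the local log. - *STM_tryC*: if status$_i$ = false, abort. For each logged update method in increasing key order: locate and lock, then run tryC_Validation; if it returns false, abort (releasing locks). Then apply each update (adjusting predecessor/current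 nodes changed by earlier updates of the same transaction): an insert of an absent key creates an unmarked node with empty rvl reachable by red and blue links; an insert of a present key updates the value, sets rvl empty, mark false, reachable by both links; a delete sets rvl empty, mark true, reachable by red links only. Release the locks, set status to commit and return commit. - *tryC_Validation*: perform rv_Validation (retry on failure). If a node for $k$ exists: let allRVL be its rvl; lock the statuses of all transactions in allRVL and of $T_i$ in a predefined order; if status$_i$ = false return false; for each $p\in$ allRVL with $p\ne i$: if $its_i<its_p$ and status$_p$ = live, add $p$ to abortRVL, otherwise return false; finally set the status of every $p\in$ abortRVL to false. Return true. *)

(* Defs.v *)
From mathcomp Require Import all_boot all_order.

Set Implicit Arguments.
Unset Strict Implicit.
Unset Printing Implicit Defensive.

(* Transactions are identified by their timestamp cts; 0 is the initial
   transaction.  The value of a key is an [option V], [None] being nil. *)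

Inductive rv_op := Lookup | Delete.

Inductive abort_cause (K : Type) := InRv of rv_op & K | InTryC | InTryA.

Arguments InTryC {K}.
Arguments InTryA {K}.

(* Methods are atomic, so an event is a whole method execution (invocation and
   response), and the order of a history is the order of the linearization
   points.  A successful tryC gives two events: [TryC i] at its linearization
   point, and [Commit i] when it returns commit, which may come later.
   [Abort i c] is the execution of the method [c] that returns abort. *)
Inductive event (K V : Type) :=
| Begin of nat
| Insert of nat & K & V
| Rv of nat & rv_op & K & option V
| TryC of nat
| Commit of nat
| Abort of nat & abort_cause K.

Arguments Begin {K V}.
Arguments Insert {K V}.
Arguments Rv {K V}.
Arguments TryC {K V}.
Arguments Commit {K V}.
Arguments Abort {K V}.

Notation history K V := (seq (event K V)).

Section Histories.

Context {d : Order.disp_t} {K : orderType d} {V : Type}.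
Implicit Types (H S A B : history K V) (e : event K V) (i j : nat) (k : K).

Definition tid e : nat :=
  match e with
  | Begin i | Insert i _ _ | Rv i _ _ _ | TryC i | Commit i | Abort i _ => i
  end.

Definition is_begin i e := if e is Begin j then j == i else false.
Definition is_tryC i e := if e is TryC j then j == i else false.
Definition is_end i e :=
  match e with Commit j | Abort j _ => j == i | _ => false end.

Definition proj H i : history K V := [seq e <- H | tid e == i].

Definition occurs i H : bool := has (fun e => tid e == i) H.
Definition terminated H i : bool := has (is_end i) H.

(* The updates of a transaction are in effect from the linearization point of
   its tryC on; the completion below makes such a transaction commit. *)
Definition committed H i : bool := has (is_tryC i) H.

Definition before (P Q : pred (event K V)) H : Prop :=
  exists A e B f C, H = A ++ e :: B ++ f :: C /\ P e /\ Q f.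

Fixpoint wf_body (s : history K V) : bool :=
  match s with
  | [::] => true
  | Insert _ _ _ :: s' | Rv _ _ _ _ :: s' => wf_body s'
  | TryC _ :: s' => match s' with [::] | [:: Commit _] => true | _ => false end
  | Abort _ _ :: s' => nilp s'
  | Begin _ :: _ | Commit _ :: _ => false
  end.

Definition wf_transaction (s : history K V) : bool :=
  match s with [::] => true | Begin _ :: s' => wf_body s' | _ => false end.

Definition well_formed H : Prop := forall i, wf_transaction (proj H i).

Fixpoint completion H : history K V :=
  match H with
  | [::] => [::]
  | e :: H' =>
      let i := tid e in
      if is_end i e || occurs i H' then e :: completion H'
      else if is_tryC i e then [:: e, Commit i & completion H']
      else [:: e, Abort i InTryA & completion H']
  end.

(* The events of a transaction are identified by their position in it, hence
   the same events means the same sequence of events for every transaction. *)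
Definition equivalent H S : Prop := forall i, proj H i = proj S i.

Definition prec_TR H i j : Prop := before (is_end i) (is_begin j) H.

Definition serial S : Prop :=
  [/\ well_formed S,
      forall i, occurs i S -> terminated S i &
      forall i j, occurs i S -> occurs j S -> i <> j ->
        prec_TR S i j \/ prec_TR S j i].

(* The initial transaction, which has no update events, updates every key (to
   nil). *)
Definition updates H i k : bool :=
  (i == 0) ||
  has (fun e => match e with
                | Insert j k' _ | Rv j Delete k' _ => (j == i) && (k' == k)
                | _ => false
                end) H.

Definition updated_value H i k : option V :=
  foldl (fun w e => match e with
                    | Insert j k' v =>
                        if (j == i) && (k' == k) then Some v else w
                    | Rv j Delete k' _ =>
                        if (j == i) && (k' == k) then None else w
                    | _ => w
                    end) None H.

(* The answer that the previous methods of transaction i on key k determine for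
   its next rv-method on k; [None] if i has not operated on k yet. *)
Definition own_value H i k : option (option V) :=
  foldl (fun w e => match e with
                    | Insert j k' v =>
                        if (j == i) && (k' == k) then Some (Some v) else w
                    | Rv j Lookup k' v =>
                        if (j == i) && (k' == k) then Some v else w
                    | Rv j Delete k' _ =>
                        if (j == i) && (k' == k) then Some None else w
                    | _ => w
                    end) None H.

Definition updaters H k : seq nat :=
  [seq j <- pmap (fun e => if e is TryC j then Some j else None) H
   | updates H j k].

(* After A, the closest previous committed transaction that updated k is i, and
   v is the value it gave to k. *)
Definition closest_update A i k (v : option V) : Prop :=
  ohead (rev (updaters A k)) = Some i /\ v = updated_value A i k.

(* An rv-method on a key on which its own transaction has already operated is
   answered locally: it must agree with the previous methods of the transaction
   and takes no part in the conflicts. *)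
Definition legal H : Prop :=
  forall A i op k v B, H = A ++ Rv i op k v :: B ->
    if own_value A i k is Some w then v = w
    else exists j, closest_update A j k v.

Definition conf_tryC_tryC H i j : Prop :=
  exists k, updates H i k /\ updates H j k /\
    before (is_tryC i) (is_tryC j) H.

Definition conf_tryC_rv H i j : Prop :=
  exists A op k v B, H = A ++ Rv j op k v :: B /\
    own_value A j k = None /\ closest_update A i k v.

Definition conf_rv_tryC H i j : Prop :=
  exists A op k v B l, H = A ++ Rv i op k v :: B /\
    own_value A i k = None /\ closest_update A l k v /\
    updates H j k /\ committed B j.

Definition prec_conf H i j : Prop :=
  i <> j /\ (conf_tryC_tryC H i j \/ conf_tryC_rv H i j \/ conf_rv_tryC H i j).

Definition co_opaque H : Prop :=
  exists S, [/\ serial S,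
    equivalent S (completion H),
    legal S,
    forall i j, prec_TR H i j -> prec_TR S i j &
    forall i j, prec_conf H i j -> prec_conf S i j].

End Histories.

Inductive node_key (K : Type) := HeadKey | Key of K | TailKey.
Arguments HeadKey {K}.
Arguments Key {K}.
Arguments TailKey {K}.

(* Nodes are referred to by their index in the heap; [nrl] and [nbl] are the red
   and blue links, and [nlock] is the transaction that holds the lock. *)
Record node (K V : Type) := Node {
  nkey : node_key K;
  nval : option V;
  nlock : option nat;
  nmark : bool;
  nrvl : seq nat;
  nrl : nat;
  nbl : nat }.

Inductive log_op (V : Type) := LLookup of option V | LInsert of V | LDelete.
Arguments LLookup {V}.
Arguments LInsert {V}.
Arguments LDelete {V}.

Variant tx_status := SLive | SCommit | SFalse.

(* Where a transaction stands in the execution, as opposed to its [status],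
   which is a variable of the algorithm.  [Effected]: past the linearization
   point of tryC, but commit is not yet returned. *)
Variant tx_phase := Idle | Running | Effected | Committed | Aborted.

Record trans (K V : Type) := Trans {
  its : nat;
  status : tx_status;
  log : seq (K * log_op V);
  phase : tx_phase }.

Record state (K V : Type) := State {
  gcounter : nat;
  heap : seq (node K V);
  txs : nat -> trans K V }.

Section Algorithm.

Context {d : Order.disp_t} {K : orderType d} {V : Type}.

Variables (M : nat) (hash : K -> 'I_M).

Implicit Types (i j p : nat) (k : K) (v : V) (w : option V).
Implicit Types (hp : seq (node K V)) (n : node K V) (s : state K V).
Implicit Types (l : seq (K * log_op V)) (t : trans K V).

Definition set_lock o n :=
  Node (nkey n) (nval n) o (nmark n) (nrvl n) (nrl n) (nbl n).
Definition add_rvl i n :=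
  Node (nkey n) (nval n) (nlock n) (nmark n) (rcons (nrvl n) i) (nrl n) (nbl n).
Definition set_rl a n :=
  Node (nkey n) (nval n) (nlock n) (nmark n) (nrvl n) a (nbl n).
Definition set_bl a n :=
  Node (nkey n) (nval n) (nlock n) (nmark n) (nrvl n) (nrl n) a.
Definition revive w n :=
  Node (nkey n) w (nlock n) false [::] (nrl n) (nbl n).
Definition delete_node n :=
  Node (nkey n) (nval n) (nlock n) true [::] (nrl n) (nbl n).

Definition dflt_node : node K V := Node TailKey None None false [::] 0 0.
Definition nd hp a : node K V := nth dflt_node hp a.
Definition upd hp a (f : node K V -> node K V) := set_nth dflt_node hp a (f (nd hp a)).

(* The sentinels of bucket b are at b.*2 and b.*2.+1. *)
Definition init_heap : seq (node K V) :=
  flatten [seq [:: Node HeadKey None None false [::] b.*2.+1 b.*2.+1;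
                   Node TailKey None None false [::] b.*2.+1 b.*2.+1]
          | b <- iota 0 M].

Definition bucket_head k : nat := (hash k : nat).*2.

Definition key_lt n k : bool :=
  match nkey n with
  | HeadKey => true
  | Key k' => (k' < k)%O
  | TailKey => false
  end.

Definition has_key n k : bool := if nkey n is Key k' then k' == k else false.

(* [walk next hp k a p c]: following [next] from a, p is the last node whose
   key is below k and c is its successor. *)
Inductive walk (next : node K V -> nat) hp k : nat -> nat -> nat -> Prop :=
| walk_stop a :
    ~~ key_lt (nd hp (next (nd hp a))) k -> walk next hp k a a (next (nd hp a))
| walk_next a p c :
    key_lt (nd hp (next (nd hp a))) k ->
    walk next hp k (next (nd hp a)) p c -> walk next hp k a p c.

Record location := Loc { bpred : nat; bcurr : nat; rpred : nat; rcurr : nat }.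

Definition locate hp k (x : location) : Prop :=
  walk (@nbl K V) hp k (bucket_head k) (bpred x) (bcurr x) /\
  walk (@nrl K V) hp k (bucket_head k) (rpred x) (rcurr x).

(* Locks are reentrant: the nodes of two keys of one tryC may coincide. *)
Definition acquire i hp (x : location) : option (seq (node K V)) :=
  let nodes := [:: bpred x; rpred x; rcurr x; bcurr x] in
  let available a :=
    if nlock (nd hp a) is Some j then j == i else true in
  if all available nodes
  then Some (foldl (fun g a => upd g a (set_lock (Some i))) hp nodes)
  else None.

Definition release i hp : seq (node K V) :=
  [seq if nlock n is Some j then
         (if j == i then set_lock None n else n)
       else n | n <- hp].

Definition rv_valid hp (x : location) : bool :=
  [&& ~~ nmark (nd hp (bpred x)), ~~ nmark (nd hp (bcurr x)),
      nbl (nd hp (bpred x)) == bcurr x & nrl (nd hp (rpred x)) == rcurr x].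

(* A method that fails to lock or to validate retries from the memory it
   started with, so only the successful attempt is represented. *)
Definition locked i hp k (x : location) hp' : Prop :=
  [/\ locate hp k x, acquire i hp x = Some hp' & rv_valid hp' x].

Definition node_exists hp k (x : location) : bool := has_key (nd hp (rcurr x)) k.

(* A logically deleted node has value nil, whatever its value field. *)
Definition node_value n : option V := if nmark n then None else nval n.

Definition log_get l k : option (log_op V) :=
  ohead [seq e.2 | e <- l & e.1 == k].
Definition log_set l k o := (k, o) :: [seq e <- l | e.1 != k].

Definition logged_value (o : log_op V) : option V :=
  match o with LLookup w => w | LInsert v => Some v | LDelete => None end.

Definition rv_entry op w : log_op V :=
  match op with Lookup => LLookup w | Delete => LDelete end.

(* A lookup answered from the log leaves an earlier insert or delete in it. *)
Definition log_rv l op k := if op is Delete then log_set l k LDelete else l.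

Definition is_update (o : log_op V) := if o is LLookup _ then false else true.

Definition log_updates l : seq (K * log_op V) :=
  sort (fun e f => (e.1 <= f.1)%O) [seq e <- l | is_update e.2].

Definition rv_access i hp k (x : location) : seq (node K V) :=
  if node_exists hp k x then upd hp (rcurr x) (add_rvl i)
  else let a := size hp in
    upd (rcons hp (Node (Key k) None None true [:: i] (rcurr x) (bcurr x)))
        (rpred x) (set_rl a).

Definition rv_value hp k (x : location) : option V :=
  if node_exists hp k x then node_value (nd hp (rcurr x)) else None.

Definition apply_insert hp k v (x : location) : seq (node K V) :=
  if node_exists hp k x then
    let hp1 := upd hp (rcurr x) (revive (Some v)) in
    if nmark (nd hp (rcurr x)) then
      upd (upd hp1 (rcurr x) (set_bl (bcurr x))) (bpred x) (set_bl (rcurr x))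
    else hp1
  else let a := size hp in
    let hp1 := rcons hp (Node (Key k) (Some v) None false [::] (rcurr x) (bcurr x)) in
    upd (upd hp1 (rpred x) (set_rl a)) (bpred x) (set_bl a).

(* Without a node for k, which happens when a transaction deletes a key that
   only itself has inserted, there is nothing to delete. *)
Definition apply_delete hp k (x : location) : seq (node K V) :=
  if node_exists hp k x then
    let hp1 := upd hp (rcurr x) delete_node in
    if nmark (nd hp (rcurr x)) then hp1
    else upd hp1 (bpred x) (set_bl (nbl (nd hp (rcurr x))))
  else hp.

Definition apply_update hp k (o : log_op V) (x : location) :=
  match o with
  | LInsert v => apply_insert hp k v x
  | LDelete => apply_delete hp k x
  | LLookup _ => hp
  end.

(* Locating each key in the heap left by the previous updates gives the
   predecessors and currents adjusted to these updates. *)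
Inductive apply_updates : seq (node K V) -> seq (K * log_op V) ->
    seq (node K V) -> Prop :=
| apply_nil hp : apply_updates hp [::] hp
| apply_cons hp k o l x hp' :
    locate hp k x -> apply_updates (apply_update hp k o x) l hp' ->
    apply_updates hp ((k, o) :: l) hp'.

Definition set_status b t := Trans (its t) b (log t) (phase t).
Definition set_log l t := Trans (its t) (status t) l (phase t).
Definition set_phase f t := Trans (its t) (status t) (log t) f.

Definition is_live b := if b is SLive then true else false.
Definition is_false b := if b is SFalse then true else false.

Definition upd_tx (tx : nat -> trans K V) i (f : trans K V -> trans K V) :=
  fun j => if j == i then f (tx j) else tx j.

(* The status part of tryC_Validation for one key: [None] if it returns false,
   the new statuses otherwise.  The status locks are held during this test only,
   which is indivisible here. *)
Definition check_rvl (tx : nat -> trans K V) i (allRVL : seq nat) :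
    option (nat -> trans K V) :=
  let others := [seq p <- allRVL | p != i] in
  if ~~ is_false (status (tx i)) &&
     all (fun p => (its (tx i) < its (tx p)) && is_live (status (tx p))) others
  then Some (fun p => if p \in others then set_status SFalse (tx p) else tx p)
  else None.

Definition tryC_check hp (tx : nat -> trans K V) i k (x : location) :=
  if node_exists hp k x then check_rvl tx i (nrvl (nd hp (rcurr x)))
  else Some tx.

(* The statuses set to false for a key remain so if the validation of a later
   key fails. *)
Inductive tryC_validation i : seq (node K V) -> (nat -> trans K V) ->
    seq (K * log_op V) -> seq (node K V) -> (nat -> trans K V) -> bool -> Prop :=
| val_nil hp tx : tryC_validation i hp tx [::] hp tx true
| val_fail hp tx k o l x hp1 :
    locked i hp k x hp1 -> tryC_check hp1 tx i k x = None ->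
    tryC_validation i hp tx ((k, o) :: l) hp1 tx false
| val_cons hp tx k o l x hp1 tx1 hp2 tx2 b :
    locked i hp k x hp1 -> tryC_check hp1 tx i k x = Some tx1 ->
    tryC_validation i hp1 tx1 l hp2 tx2 b ->
    tryC_validation i hp tx ((k, o) :: l) hp2 tx2 b.

Definition idle_trans : trans K V := Trans 0 SLive [::] Idle.

(* The initial transaction has timestamp 0 and has already committed. *)
Definition init_state : state K V :=
  State 1 init_heap
    (fun i => if i == 0 then Trans 0 SCommit [::] Committed else idle_trans).

Definition start s (first : nat) : state K V :=
  State (gcounter s).+1 (heap s)
    (upd_tx (txs s) (gcounter s) (fun=> Trans first SLive [::] Running)).

(* [first] is the timestamp its of a transaction all of whose incarnations have
   aborted. *)
Definition retryable s (first : nat) : Prop :=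
  (exists p, phase (txs s p) = Aborted /\ its (txs s p) = first) /\
  (forall p, phase (txs s p) <> Idle -> its (txs s p) = first ->
     phase (txs s p) = Aborted).

(* Each method is a single step.  The status variable of a transaction that
   returns abort is left as it is: only its [phase] records the abort. *)
Inductive step : state K V -> event K V -> state K V -> Prop :=
| step_begin s :
    step s (Begin (gcounter s)) (start s (gcounter s))
| step_retry s first :
    retryable s first ->
    step s (Begin (gcounter s)) (start s first)
| step_insert s i k v :
    phase (txs s i) = Running ->
    step s (Insert i k v)
      (State (gcounter s) (heap s)
         (upd_tx (txs s) i (set_log (log_set (log (txs s i)) k (LInsert v)))))
| step_rv_log s i op k o :
    phase (txs s i) = Running ->
    log_get (log (txs s i)) k = Some o ->
    step s (Rv i op k (logged_value o))
      (State (gcounter s) (heap s)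
         (upd_tx (txs s) i (set_log (log_rv (log (txs s i)) op k))))
| step_rv_abort s i op k :
    phase (txs s i) = Running ->
    log_get (log (txs s i)) k = None ->
    status (txs s i) = SFalse ->
    step s (Abort i (InRv op k))
      (State (gcounter s) (heap s) (upd_tx (txs s) i (set_phase Aborted)))
| step_rv s i op k x hp :
    phase (txs s i) = Running ->
    log_get (log (txs s i)) k = None ->
    status (txs s i) <> SFalse ->
    locked i (heap s) k x hp ->
    step s (Rv i op k (rv_value hp k x))
      (State (gcounter s) (release i (rv_access i hp k x))
         (upd_tx (txs s) i
            (set_log (log_set (log (txs s i)) k (rv_entry op (rv_value hp k x))))))
| step_tryA s i :
    phase (txs s i) = Running ->
    step s (Abort i InTryA)
      (State (gcounter s) (heap s) (upd_tx (txs s) i (set_phase Aborted)))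
| step_tryC_abort s i :
    phase (txs s i) = Running ->
    status (txs s i) = SFalse ->
    step s (Abort i InTryC)
      (State (gcounter s) (heap s) (upd_tx (txs s) i (set_phase Aborted)))
| step_tryC_invalid s i hp tx :
    phase (txs s i) = Running ->
    status (txs s i) <> SFalse ->
    tryC_validation i (heap s) (txs s) (log_updates (log (txs s i))) hp tx false ->
    step s (Abort i InTryC)
      (State (gcounter s) (release i hp) (upd_tx tx i (set_phase Aborted)))
| step_tryC s i hp tx hp' :
    phase (txs s i) = Running ->
    status (txs s i) <> SFalse ->
    tryC_validation i (heap s) (txs s) (log_updates (log (txs s i))) hp tx true ->
    apply_updates hp (log_updates (log (txs s i))) hp' ->
    step s (TryC i)
      (State (gcounter s) (release i hp')
         (upd_tx tx i (fun t => set_phase Effected (set_status SCommit t))))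
| step_commit s i :
    phase (txs s i) = Effected ->
    step s (Commit i)
      (State (gcounter s) (heap s) (upd_tx (txs s) i (set_phase Committed))).

Inductive execution : history K V -> state K V -> Prop :=
| exec_init : execution [:: Begin 0; TryC 0; Commit 0] init_state
| exec_step H s e s' :
    execution H s -> step s e s' -> execution (rcons H e) s'.

Definition generated (H : history K V) : Prop := exists s, execution H s.

End Algorithm.

(* Main.v *)
Require Import Defs.
From mathcomp Require Import all_boot all_order.

(* Serialize each transaction at its anchor: the last of its begin, its tryC and
   its rv-methods answered from shared memory.  Real-time order and the order
   of the tryC's are respected because each anchor lies within its transaction.
   The algorithm is needed for one fact only: if T_i reads k from shared memory
   and T_j, updating k, later executes tryC, then T_i has either committed in
   between or has status false ever after, and so has no further anchor.  Indeed
   i stays in the rvl of the node of k (which the sorted red list always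
   reaches) until a validation for k sets the status of T_i to false.  Hence the
   updates of k that precede a read of k in H are exactly those serialized before
   the reading transaction, and the read sees the same closest update in both
   histories. *)

Set Implicit Arguments.
Unset Strict Implicit.
Unset Printing Implicit Defensive.

(** * Serialization of a history *)

(** Co-opacity places aborted and live transactions too, so each of them needs a point at which all
    its shared reads hold together. The obstacle is that status false does not stop a transaction:
    it may go on with inserts, with answers from its log and with tryA. If such events counted as
    anchors, an invalidated transaction would move behind the tryC that invalidated it. The begin
    counts because every transaction needs a point, even one without shared reads or tryC. For a
    committing transaction the point is the tryC and not the commit event, since updates take effect
    at the tryC and commit events may come in a different order. The alternative that the reader has
    committed cannot be dropped: the tryC of a transaction empties the rvl of the keys that it
    updates itself, and its own status does not become false by that. The values read are supplied
    by the legality of the history, so the invariants of the algorithm only follow keys, red links,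
    read lists, statuses and logs. *)

Lemma has_split (T : Type) (a : pred T) (s : seq T) :
  has a s -> exists s1 x s2, s = s1 ++ x :: s2 /\ a x.
Proof.
elim: s => //= x s IHs /orP [ax|/IHs [s1 [y [s2 [-> ay]]]]].
  by exists [::], x, s.
by exists (x :: s1), y, s2.
Qed.

Lemma split_lt (T : Type) (s1 s2 t1 t2 : seq T) x y :
  s1 ++ x :: s2 = t1 ++ y :: t2 -> size s1 < size t1 ->
  exists z, t1 = s1 ++ x :: z /\ s2 = z ++ y :: t2.
Proof.
elim: s1 t1 => [|a s1 IHs] [|b t1] //= [].
  by move=> -> -> _; exists t1.
by move=> -> /IHs IH /IH [z [-> ->]]; exists z.
Qed.

Lemma split_eq (T : Type) (s1 s2 t1 t2 : seq T) x y :
  s1 ++ x :: s2 = t1 ++ y :: t2 -> size s1 = size t1 ->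
  [/\ s1 = t1, x = y & s2 = t2].
Proof.
elim: s1 t1 => [|a s1 IHs] [|b t1] //= []; first by move=> -> ->.
by move=> -> /IHs IH [] /IH [-> -> ->].
Qed.

Lemma cat_split (T : Type) (A B s1 s2 : seq T) x :
  A ++ B = s1 ++ x :: s2 ->
  (exists q, A = s1 ++ x :: q /\ s2 = q ++ B) \/
  (exists p, s1 = A ++ p /\ B = p ++ x :: s2).
Proof.
elim: A s1 => [|a A IHA] [|b s1] /=.
- by move->; right; exists [::].
- by move->; right; exists (b :: s1).
- by case=> -> <-; left; exists A.
case=> -> /IHA [[q [-> ->]]|[p [-> ->]]]; first by left; exists q.
by right; exists p.
Qed.

Lemma flatten_map_split (I : eqType) (T : Type) (f : I -> seq T) r s1 x s2 :
  flatten [seq f i | i <- r] = s1 ++ x :: s2 ->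
  exists r1 i r2 p q,
    [/\ r = r1 ++ i :: r2, f i = p ++ x :: q,
        s1 = flatten [seq f i | i <- r1] ++ p &
        s2 = q ++ flatten [seq f i | i <- r2]].
Proof.
elim: r s1 => [|i r IHr] s1 /=; first by case: s1.
move=> E; have [[q [Ei ->]]|[p [-> /IHr]]] := cat_split E; last first.
  case=> r1 [j [r2 [p' [q [-> Ej -> ->]]]]].
  by exists (i :: r1), j, r2, p', q; rewrite /= catA.
by exists [::], i, r, s1, q.
Qed.

Lemma mem_split (T : eqType) (x : T) s : x \in s -> exists s1 s2, s = s1 ++ x :: s2.
Proof. by case/path.splitPr=> s1 s2; exists s1, s2. Qed.

Section Histories.

Context {d : Order.disp_t} {K : orderType d} {V : Type}.
Implicit Types (H S A B C X Y : history K V) (e : event K V) (i j : nat) (k : K).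

(** * Projections to one transaction, and its completion *)

Definition closing e : bool := is_end (tid e) e.

Lemma is_endE i e : is_end i e = (tid e == i) && closing e.
Proof. by case: e => //= *; rewrite ?andbF // /closing /= eqxx andbT. Qed.

Lemma proj_cat A B i : proj (A ++ B) i = proj A i ++ proj B i.
Proof. exact: filter_cat. Qed.

Lemma proj_cons e A i :
  proj (e :: A) i = if tid e == i then e :: proj A i else proj A i.
Proof. by []. Qed.

Lemma proj_rcons A e i :
  proj (rcons A e) i = if tid e == i then rcons (proj A i) e else proj A i.
Proof. exact: filter_rcons. Qed.

Lemma all_tid_proj A i : all (fun e => tid e == i) (proj A i).
Proof. exact: filter_all. Qed.

Lemma proj_proj A i j : proj (proj A i) j = if i == j then proj A i else [::].
Proof.
rewrite /proj -filter_predI; case: eqP => [->|ne].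
  by apply: eq_filter => e /=; rewrite andbb.
rewrite -(filter_pred0 A); apply: eq_filter => e /=.
by apply/negP=> /andP [/eqP Ei /eqP Ej]; apply: ne; rewrite -Ei.
Qed.

Lemma occurs_proj A i : occurs i A = ~~ nilp (proj A i).
Proof. by elim: A => //= e A IHA; case: ifP. Qed.

Lemma proj_split A i P e Q : proj A i = P ++ e :: Q ->
  exists A1 A2, [/\ A = A1 ++ e :: A2, proj A1 i = P & proj A2 i = Q].
Proof.
elim: A P => [|f A IHA] P; first by case: P.
rewrite proj_cons; case: ifP => Ef; last first.
  by case/IHA=> A1 [A2 [-> <- <-]]; exists (f :: A1), A2; rewrite /= Ef.
case: P => [[<- <-]|g P [<-]]; first by exists [::], A.
by case/IHA=> A1 [A2 [-> <- <-]]; exists (f :: A1), A2; rewrite /= Ef.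
Qed.

Lemma committed_split A i :
  committed A i -> exists A1 A2, A = A1 ++ TryC i :: A2.
Proof.
case/has_split=> A1 [e [A2 [-> ]]]; case: e => //= j /eqP ->.
by exists A1, A2.
Qed.

Lemma committed_mid A B i : committed (A ++ TryC i :: B) i.
Proof. by rewrite /committed has_cat /= eqxx orbT. Qed.

Lemma committed_proj A i : committed (proj A i) i = committed A i.
Proof.
rewrite /committed; elim: A => //= e A <-.
by case: ifP => //=; case: e => //= j ->.
Qed.

Lemma updates_proj A i k : updates A i k = updates (proj A i) i k.
Proof.
rewrite /updates; congr orb; elim: A => //= e A ->.
case: ifP => //= Ee.
by case: e Ee => //= [j k' v ->|j [] k' v] //= ->.
Qed.

Lemma foldl_proj (W : Type) (f : W -> event K V -> W) w A i :
  (forall w' e, tid e != i -> f w' e = w') -> foldl f w A = foldl f w (proj A i).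
Proof.
move=> f_id; elim: A w => //= e A IHA w.
by case: ifP => [_|/negbT/f_id ->]; rewrite IHA.
Qed.

Lemma updated_value_proj A i k : updated_value A i k = updated_value (proj A i) i k.
Proof.
by apply: foldl_proj => w [] //= => [j k' v /negPf -> //|j [] // k' v /negPf ->].
Qed.

Lemma own_value_proj A i k : own_value A i k = own_value (proj A i) i k.
Proof.
by apply: foldl_proj => w [] //= => [j k' v /negPf -> //|j [] // k' v /negPf ->].
Qed.

Lemma updates_closing A B i k :
  all closing B -> updates (A ++ B) i k = updates A i k.
Proof.
move=> clB; rewrite /updates has_cat orbA; apply/orb_idr => hasB; exfalso.
elim: B clB hasB => //= e B IHB /andP [cl_e clB].
by case: e cl_e => //= *; apply: IHB.
Qed.

Lemma updated_value_closing A B i k :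
  all closing B -> updated_value (A ++ B) i k = updated_value A i k.
Proof.
move=> clB; rewrite /updated_value foldl_cat; move: (foldl _ _ A).
elim: B clB => //= e B IHB /andP [cl_e clB] w.
by case: e cl_e => //= *; apply: IHB.
Qed.

Lemma wf_body_after_tryC A j B : wf_body (A ++ TryC j :: B) -> all closing B.
Proof.
elim: A => [|e A IHA] /=.
  by case: B => // -[] //= i [] //= _; rewrite /closing /= eqxx.
by case: e => //= _; case: A IHA => // -[] // ? [].
Qed.

Lemma wf_after_tryC A j B :
  wf_transaction (A ++ TryC j :: B) -> all closing B.
Proof. by case: A => //= -[] //= _ A; apply: wf_body_after_tryC. Qed.

Lemma wf_body_after_closing A e B :
  closing e -> wf_body (A ++ e :: B) -> B = [::].
Proof.
move=> cl_e; elim: A => [|f A IHA] /=.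
  by case: e cl_e => //= _ _ _; case: B.
case: f => //= _; last by case: A {IHA}.
by case: A IHA cl_e => [|[] // ? [|]] //=; case: e => //= ? _; case: B.
Qed.

Lemma wf_after_closing A e B :
  closing e -> wf_transaction (A ++ e :: B) -> B = [::].
Proof.
case: A => [|[] //= _ A]; first by case: e.
exact: wf_body_after_closing.
Qed.

Lemma completion_cons e A :
  completion (e :: A) =
  if is_end (tid e) e || occurs (tid e) A then e :: completion A
  else if is_tryC (tid e) e then [:: e, Commit (tid e) & completion A]
  else [:: e, Abort (tid e) InTryA & completion A].
Proof. by []. Qed.

(** What [completion] adds after an event depends only on the later events of the same transaction.
    Completed transactions can therefore be studied one at a time. *)
Lemma completion_proj A i : proj (completion A) i = completion (proj A i).
Proof.
elim: A => // e A IHA; rewrite completion_cons proj_cons.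
case Ee: (tid e == i).
  rewrite completion_cons -IHA !occurs_proj proj_proj (eqP Ee) eqxx.
  by case: (_ || _); [|case: (is_tryC _ _)]; rewrite /= ?Ee ?eqxx.
by case: (_ || _); [|case: (is_tryC _ _)]; rewrite /= ?Ee IHA.
Qed.

(** The event [e] in front carries the induction: once [s] is empty, it is [e] that gets the abort
    behind it. A commit is added only when [s] ends with a tryC. *)
Lemma completion_body i e s :
  tid e = i -> ~~ is_end i e -> ~~ is_tryC i e ->
  all (fun f => tid f == i) s -> wf_body s ->
  exists u, [/\ completion (e :: s) = e :: s ++ u, all closing u,
    wf_body (s ++ u) & has (is_end i) (s ++ u)].
Proof.
elim: s e => [|f s IHs] e Ee.
  move=> /negPf endE /negPf tryE _ _; rewrite completion_cons Ee endE tryE.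
  by exists [:: Abort i InTryA]; rewrite /= /closing /= eqxx.
move=> _ _ /= /andP [/eqP Ef tid_s] wf_fs.
rewrite -/(completion (e :: f :: s)) completion_cons Ee [occurs _ _]/= Ef eqxx orbT.
case: f Ef wf_fs => //=.
- move=> j k v ej wf_s.
  have [//|//|//|//|//|u [E clu wfu endu]] := IHs (Insert j k v).
  by exists u; split=> //; congr cons; exact: E.
- move=> j op k v ej wf_s.
  have [//|//|//|//|//|u [E clu wfu endu]] := IHs (Rv j op k v).
  by exists u; split=> //; congr cons; exact: E.
- move=> j ->; case: s {IHs} tid_s => [_ _|[] //= l [] //= /andP [/eqP -> _] _].
    by exists [:: Commit i]; rewrite /= /closing /= !eqxx.
  by exists [::]; rewrite /= /closing /= !eqxx.
move=> j c ->; case: s {IHs} tid_s => // _ _.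
by exists [::]; rewrite /= /closing /= !eqxx.
Qed.

Lemma completion_transaction A i : wf_transaction (proj A i) ->
  exists u, [/\ proj (completion A) i = proj A i ++ u, all closing u,
    wf_transaction (proj A i ++ u) &
    occurs i A -> has (is_end i) (proj A i ++ u)].
Proof.
rewrite completion_proj occurs_proj; have := all_tid_proj A i.
case: (proj A i) => [|[] //= j s /andP [/eqP -> tid_s] wf_s].
  by exists [::].
have [//|//|u [E clu wfu endu]] := @completion_body i (Begin i) s erefl _ _ tid_s wf_s.
by exists u; split; rewrite // -/(completion (_ :: _)) E.
Qed.


(** * Closest updates and anchors *)

Definition tryC_tid e : option nat := if e is TryC j then Some j else None.

Lemma updatersE A k :
  updaters A k = [seq j <- pmap tryC_tid A | updates A j k].
Proof. by []. Qed.

Lemma mem_tryC A j : (j \in pmap tryC_tid A) = committed A j.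
Proof.
rewrite /committed; elim: A => //= e A IHA.
by case: e => //= i; rewrite in_cons IHA eq_sym.
Qed.

(** Stated for a fixed predicate [p], because [updates A] changes together with [A] and would block
    the induction. *)
Lemma last_tryCP (p : pred nat) A j :
  ohead (rev [seq l <- pmap tryC_tid A | p l]) = Some j <->
  exists A1 A2, [/\ A = A1 ++ TryC j :: A2, p j &
    forall l, committed A2 l -> ~~ p l].
Proof.
split=> [|[A1 [A2 [-> p_j after_j]]]]; last first.
  rewrite pmap_cat filter_cat /= p_j rev_cat rev_cons.
  suff ->: [seq l <- pmap tryC_tid A2 | p l] = [::] by [].
  apply/eqP; rewrite -[_ == _]negbK -has_filter -all_predC.
  by apply/allP=> l; rewrite mem_tryC; apply: after_j.
elim/last_ind: A => // A e IHA.
have skip: (forall l, tryC_tid e = Some l -> ~~ p l) ->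
    ohead (rev [seq l <- pmap tryC_tid A | p l]) = Some j ->
    exists A1 A2, [/\ rcons A e = A1 ++ TryC j :: A2, p j &
      forall l, committed A2 l -> ~~ p l].
  move=> p_e /IHA [A1 [A2 [-> p_j after_j]]].
  exists A1, (rcons A2 e); rewrite rcons_cat; split=> // l.
  rewrite /committed has_rcons => /orP [|/after_j //].
  by case: e p_e {IHA} => //= i p_i /eqP <-; apply: p_i.
rewrite -cats1 pmap_cat filter_cat cats1.
case Ee: (tryC_tid e) => [i|]; last first.
  by rewrite /= Ee cats0; apply: skip; rewrite Ee.
rewrite /= Ee /=; case: ifP => p_i; last first.
  by rewrite cats0; apply: skip; rewrite Ee => _ [<-]; rewrite p_i.
rewrite rev_cat => -[<-]; exists A, [::]; rewrite cats1.
by split=> //; case: e Ee {IHA skip} => //= ? [->].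
Qed.

Lemma closest_updateP A j k v :
  closest_update A j k v <->
  exists A1 A2, [/\ A = A1 ++ TryC j :: A2, updates A j k,
    forall l, committed A2 l -> ~~ updates A l k & v = updated_value A j k].
Proof.
rewrite /closest_update updatersE; split.
  by case=> /last_tryCP [A1 [A2 [? ? ?]]] ?; exists A1, A2.
by case=> A1 [A2 [? ? ? ?]]; split=> //; apply/last_tryCP; exists A1, A2.
Qed.

(** [X] is the history before [e]: an own value in it is the trace, at the level of histories, of a
    log entry, and so of a local answer. *)
Definition anchor X e i : bool :=
  match e with
  | Begin j | TryC j => j == i
  | Rv j _ k _ => (j == i) && ~~ isSome (own_value X i k)
  | _ => false
  end.

Lemma anchor_tid X e i : anchor X e i -> tid e = i.
Proof. by case: e => //= => [j /eqP|j op k v /andP [/eqP]|j /eqP]. Qed.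

Lemma anchor_closing X e i : closing e -> ~~ anchor X e i.
Proof. by case: e. Qed.

Definition anchor_at H i n : bool :=
  if drop n H is e :: _ then anchor (take n H) e i else false.

Lemma anchor_atE X e Y i : anchor_at (X ++ e :: Y) i (size X) = anchor X e i.
Proof. by rewrite /anchor_at drop_size_cat // take_size_cat. Qed.

(** The value 0 for a transaction without anchor is harmless: positions are compared only for
    transactions that occur, and these have their begin as an anchor. *)
Definition ser_point H i : nat := \max_(n < size H | anchor_at H i n) n.

Lemma ser_point_ge X e Y i : anchor X e i -> size X <= ser_point (X ++ e :: Y) i.
Proof.
move=> anc; have lt_X: size X < size (X ++ e :: Y).
  by rewrite size_cat /= addnS ltnS leq_addr.
apply: (@leq_bigmax_cond _ _ _ (Ordinal lt_X)).
by rewrite /= anchor_atE.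
Qed.

Definition shared_rv H i k : Prop :=
  exists A op v B, H = A ++ Rv i op k v :: B /\ own_value A i k = None.

(* An update has invalidated what transaction i has read. *)
Definition doomed H i : Prop :=
  exists A j B k, [/\ H = A ++ TryC j :: B, shared_rv A i k, updates A j k,
    j <> i & ~~ committed A i].

Definition no_anchor_if_doomed H : Prop :=
  forall X e Y i, H = X ++ e :: Y -> doomed X i -> ~~ anchor X e i.

(** * Positions of the anchors *)

Section Serialization.

Variable H : history K V.
Hypothesis wfH : well_formed H.
Hypothesis doomH : no_anchor_if_doomed H.
Hypothesis legalH : legal H.

Local Notation pt := (ser_point H).
Local Notation C := (completion H).

Lemma after_tryC A j B : H = A ++ TryC j :: B -> all closing (proj B j).
Proof.
move=> E; have := wfH j; rewrite E proj_cat proj_cons /= eqxx.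
exact: wf_after_tryC.
Qed.

Lemma after_closing A e B : closing e -> H = A ++ e :: B -> ~~ occurs (tid e) B.
Proof.
move=> cl_e E; have := wfH (tid e); rewrite E proj_cat proj_cons /= eqxx.
by move/(wf_after_closing cl_e); rewrite occurs_proj => ->.
Qed.

(** Only closing events follow a tryC, so updates are settled there. This links the closest updates,
    evaluated in a prefix, with the updaters of a conflict, evaluated in the whole history. *)
Lemma updates_prefix A j B k :
  H = A ++ B -> committed A j -> updates A j k = updates H j k /\
  updated_value A j k = updated_value H j k.
Proof.
move=> EH /committed_split [A1 [A2 EA]].
have EHj: H = A1 ++ TryC j :: A2 ++ B by rewrite EH EA -catA.
have := after_tryC EHj; rewrite proj_cat all_cat => /andP [_ clB].
split.
  by rewrite updates_proj [RHS]updates_proj EH proj_cat updates_closing.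
by rewrite updated_value_proj [RHS]updated_value_proj EH proj_cat updated_value_closing.
Qed.

Lemma updates_before_tryC A j B k :
  H = A ++ TryC j :: B -> updates A j k = updates H j k.
Proof.
move=> EH; have EH': H = rcons A (TryC j) ++ B by rewrite cat_rcons.
have com_j: committed (rcons A (TryC j)) j by rewrite -cats1 committed_mid.
have [<- _] := updates_prefix k EH' com_j.
by rewrite /updates -cats1 has_cat /= orbF.
Qed.

Lemma ser_point_attained i : occurs i H ->
  exists X e Y, [/\ H = X ++ e :: Y, anchor X e i & pt i = size X].
Proof.
move=> occ_i; have := wfH i; move: (occ_i); rewrite occurs_proj.
case Ei: (proj H i) => [//|e s] _ /=; case: e Ei => // j Ei _.
have [A [B [EH _ _]]] := @proj_split H i [::] _ _ Ei.
have ji: j = i.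
  by have := all_tid_proj H i; rewrite Ei /= => /andP [/eqP].
have lt_A: size A < size H by rewrite EH size_cat /= addnS ltnS leq_addr.
(* The begin makes the set under the maximum nonempty. *)
have anc_A: anchor_at H i (Ordinal lt_A).
  by rewrite /= EH anchor_atE /= ji.
have [n anc_n En] := @eq_bigmax_cond _ (fun n : 'I_(size H) => anchor_at H i n)
  (fun n => val n) (ltac:(by apply/card_gt0P; exists (Ordinal lt_A))).
have -> : pt i = n by exact: En.
move: anc_n; rewrite unfold_in /= /anchor_at.
case EY: (drop n H) => [//|e Y] anc; exists (take n H), e, Y.
by rewrite -EY cat_take_drop size_take ltn_ord.
Qed.

Lemma ser_point_inj i j : occurs i H -> occurs j H -> pt i = pt j -> i = j.
Proof.
move=> /ser_point_attained [X [e [Y [EH anc_i ->]]]].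
move=> /ser_point_attained [X' [e' [Y' [EH' anc_j ->]]]] sz.
have [_ ee' _] := split_eq (etrans (esym EH) EH') sz.
by rewrite -(anchor_tid anc_i) -(anchor_tid anc_j) ee'.
Qed.

Lemma ser_point_tryC A i B : H = A ++ TryC i :: B -> pt i = size A.
Proof.
move=> EH; apply/eqP; rewrite eqn_leq {2}EH ser_point_ge ?andbT /= ?eqxx //.
have /ser_point_attained [X [e [Y [EH' anc ->]]]] : occurs i H.
  by rewrite EH /occurs has_cat /= eqxx orbT.
rewrite leqNgt; apply/negP=> lt_AX.
have [Z [_ EB]] := split_lt (etrans (esym EH) EH') lt_AX.
have := after_tryC EH; rewrite EB proj_cat proj_cons (anchor_tid anc) eqxx.
by rewrite all_cat /= => /andP [_ /andP [/(anchor_closing X i)]]; rewrite anc.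
Qed.

Lemma ser_point_prec_TR i j : prec_TR H i j ->
  [/\ occurs i H, occurs j H & pt i < pt j].
Proof.
case=> A [e [B [f [D [EH [end_e beg_f]]]]]].
move: end_e; rewrite is_endE => /andP [/eqP Ee cl_e].
have anc_f: anchor (A ++ e :: B) f j by case: f {EH} beg_f.
have occ_i: occurs i H by rewrite EH /occurs has_cat /= Ee eqxx orbT.
split=> //.
  by rewrite EH /occurs has_cat /= has_cat /= (anchor_tid anc_f) eqxx !orbT.
have le_f: size (A ++ e :: B) <= pt j.
  by rewrite EH -cat_cons catA ser_point_ge.
apply: leq_trans le_f; rewrite size_cat /= addnS ltnS.
apply: leq_trans (leq_addr _ _).
have [X [g [Y [EH' anc ->]]]] := ser_point_attained occ_i.
rewrite leqNgt; apply/negP=> lt_AX.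
have [Z [_ EB]] := split_lt (etrans (esym EH) EH') lt_AX.
have := after_closing cl_e EH; rewrite EB /occurs has_cat /= Ee.
by rewrite (anchor_tid anc) eqxx orbT.
Qed.

(** A tryC before the read lies before an anchor of [i]. If the tryC of [j] comes after the read,
    either [i] has committed in between, and its point is that earlier tryC, or [i] is doomed from
    the tryC of [j] on and all its anchors lie before. *)
Lemma ser_point_updater A i op k v B j : H = A ++ Rv i op k v :: B ->
  own_value A i k = None -> updates H j k -> j <> i -> committed H j ->
  if committed A j then pt j < pt i else pt i < pt j.
Proof.
move=> EH own_A upd_j ne_ji com_j.
case: ifP => [/committed_split [A1 [A2 EA]]|ncom_A].
  have EHj: H = A1 ++ TryC j :: A2 ++ Rv i op k v :: B by rewrite EH EA -catA.
  rewrite (ser_point_tryC EHj).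
  apply: (@leq_trans (size A)); first by rewrite EA size_cat /= addnS ltnS leq_addr.
  by rewrite EH ser_point_ge //= eqxx own_A.
have [B1 [B2 EB]]: exists B1 B2, B = B1 ++ TryC j :: B2.
  apply: committed_split; move: com_j; rewrite EH /committed has_cat /=.
  by rewrite -/(committed A j) ncom_A.
have EHj: H = (A ++ Rv i op k v :: B1) ++ TryC j :: B2.
  by rewrite EH EB -catA.
rewrite (ser_point_tryC EHj).
have [com_i|ncom_i] := boolP (committed (A ++ Rv i op k v :: B1) i).
  have [D1 [D2 ED]] := committed_split com_i.
  have EHi: H = D1 ++ TryC i :: D2 ++ TryC j :: B2 by rewrite EHj ED -catA.
  by rewrite (ser_point_tryC EHi) ED size_cat /= addnS ltnS leq_addr.
(* Here the tryC of [j] dooms [i], and an anchor of [i] at or after it is refuted. *)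
have occ_i: occurs i H by rewrite EH /occurs has_cat /= eqxx orbT.
have [X [e [Y [EH' anc ->]]]] := ser_point_attained occ_i.
rewrite ltnNge; apply/negP; rewrite leq_eqVlt => /orP [/eqP sz|lt_X].
  have [_ ee' _] := split_eq (etrans (esym EHj) EH') sz.
  by apply: ne_ji; rewrite -(anchor_tid anc) -ee'.
have [Z [EX EB2]] := split_lt (etrans (esym EHj) EH') lt_X.
suff /(doomH EH') : doomed X i by rewrite anc.
exists (A ++ Rv i op k v :: B1), j, Z, k; split=> //.
  by exists A, op, v, B1.
by rewrite (updates_before_tryC k EHj).
Qed.

(** * The serial history *)

Definition ser_order : seq nat :=
  sort (fun i j => pt i <= pt j) (undup (map tid H)).

Lemma mem_ser_order i : (i \in ser_order) = occurs i H.
Proof.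
rewrite mem_sort mem_undup /occurs; elim: H => //= e A IHA.
by rewrite in_cons IHA eq_sym.
Qed.

Lemma ser_order_uniq : uniq ser_order.
Proof. by rewrite sort_uniq undup_uniq. Qed.

(** Sorting gives only weak inequalities; they are strict because two transactions never share an
    anchor. *)
Lemma ser_order_split L1 i L2 : ser_order = L1 ++ i :: L2 ->
  (forall j, (j \in L1) = occurs j H && (pt j < pt i)) /\
  (forall j, (j \in L2) = occurs j H && (pt i < pt j)).
Proof.
move=> EL.
have le_total: total (fun i j => pt i <= pt j) by move=> a b; apply: leq_total.
have le_trans: transitive (fun i j => pt i <= pt j).
  by move=> a b c; apply: leq_trans.
have := sort_sorted le_total (undup (map tid H)).
rewrite -/ser_order EL (sorted_pairwise le_trans) pairwise_cat /=.
case/and3P=> /allrelP le12 _ /andP [/allP le2 _].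
have := ser_order_uniq; rewrite EL cat_uniq /=.
case/and4P=> _ /norP [niL1 _] niL2 _.
have occE j : occurs j H = (j \in L1) || (j == i) || (j \in L2).
  by rewrite -mem_ser_order EL mem_cat in_cons orbA.
have occ_i: occurs i H by rewrite occE eqxx orbT.
have lt1 j : j \in L1 -> pt j < pt i.
  move=> jL1; rewrite ltn_neqAle le12 ?mem_head // andbT.
  apply/eqP=> /ser_point_inj Eji; move: niL1.
  by rewrite -Eji ?jL1 // occE jL1.
have lt2 j : j \in L2 -> pt i < pt j.
  move=> jL2; rewrite ltn_neqAle le2 // andbT.
  apply/eqP=> /ser_point_inj Eij; move: niL2.
  by rewrite Eij ?jL2 // occE jL2 orbT.
split=> j; apply/idP/andP.
- by move=> jL1; rewrite lt1 // occE jL1.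
- case; rewrite occE => /orP [/orP [//|/eqP ->]|/lt2]; first by rewrite ltnn.
  by move/ltn_trans=> lt /lt; rewrite ltnn.
- by move=> jL2; rewrite lt2 // occE jL2 orbT.
case; rewrite occE => /orP [/orP [/lt1|/eqP ->]|//]; last by rewrite ltnn.
by move/ltn_trans=> lt /lt; rewrite ltnn.
Qed.

Definition serialize (L : seq nat) : history K V := flatten [seq proj C i | i <- L].

Lemma proj_serialize L i :
  uniq L -> proj (serialize L) i = if i \in L then proj C i else [::].
Proof.
elim: L => //= j L IHL /andP [njL uL].
rewrite /serialize /= proj_cat proj_proj -/(serialize L) IHL // in_cons eq_sym.
by case: eqP njL => //= -> /negPf ->; rewrite cats0.
Qed.

Lemma serialize_cat L1 L2 : serialize (L1 ++ L2) = serialize L1 ++ serialize L2.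
Proof. by rewrite /serialize map_cat flatten_cat. Qed.

Lemma serialize_cons i L : serialize (i :: L) = proj C i ++ serialize L.
Proof. by []. Qed.

Lemma proj_completionE i : exists u,
  [/\ proj C i = proj H i ++ u, all closing u, wf_transaction (proj H i ++ u) &
    occurs i H -> has (is_end i) (proj H i ++ u)].
Proof. exact: completion_transaction. Qed.

Lemma committed_completion j : committed (proj C j) j = committed H j.
Proof.
have [u [-> clu _ _]] := proj_completionE j.
rewrite -[RHS]committed_proj /committed has_cat orbC.
by elim: u clu => //= e u IHu /andP [cl_e /IHu]; case: e cl_e.
Qed.

Lemma committed_serialize L j :
  uniq L -> committed (serialize L) j = (j \in L) && committed H j.
Proof.
move=> uL; rewrite -committed_proj proj_serialize //.
by case: ifP => // _; rewrite committed_completion.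
Qed.

Definition ser : history K V := serialize ser_order.

Lemma proj_ser i : proj ser i = proj C i.
Proof.
rewrite proj_serialize ?ser_order_uniq // mem_ser_order.
case: ifP => // /negbT; rewrite occurs_proj negbK completion_proj => /nilP.
by move=> ->.
Qed.

Lemma updates_ser i k : updates ser i k = updates H i k.
Proof.
rewrite updates_proj proj_ser [in RHS]updates_proj.
by have [u [-> clu _ _]] := proj_completionE i; rewrite updates_closing.
Qed.

Lemma occurs_ser i : occurs i ser = occurs i H.
Proof.
rewrite !occurs_proj proj_ser completion_proj.
by case: (proj H i) => //= e s; case: ifP => //; case: ifP.
Qed.

Lemma ser_order_split2 i j : occurs i H -> occurs j H -> pt i < pt j ->
  exists L1 L2 L3, ser_order = L1 ++ i :: L2 ++ j :: L3.
Proof.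
move=> occ_i occ_j lt_ij; have := occ_i; rewrite -mem_ser_order.
case/mem_split=> L1 [L2 EL]; have [_ inL2] := ser_order_split EL.
have jL2: j \in L2 by rewrite inL2 occ_j.
by have [L3 [L4 EL2]] := mem_split jL2; exists L1, L3, L4; rewrite EL EL2.
Qed.

Lemma ser_prec_TR i j : occurs i H -> occurs j H -> pt i < pt j -> prec_TR ser i j.
Proof.
move=> occ_i occ_j lt_ij.
have [L1 [L2 [L3 EL]]] := ser_order_split2 occ_i occ_j lt_ij.
have [u [Ei _ _ /(_ occ_i)]] := proj_completionE i.
rewrite -Ei => /has_split [P [e [Q [EPQ end_e]]]].
have [w [Ej _ wfj _]] := proj_completionE j.
have [f [R [ER beg_f]]] : exists f R, proj C j = f :: R /\ is_begin j f.
  have := occ_j; rewrite occurs_proj Ej; have := all_tid_proj H j.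
  case: (proj H j) wfj => [//|[] //= l s _ /andP [lj _] _].
  by exists (Begin l), (s ++ w).
exists (serialize L1 ++ P), e, (Q ++ serialize L2), f, (R ++ serialize L3).
by rewrite /ser EL !(serialize_cat, serialize_cons) ER EPQ -!catA /= -?catA.
Qed.

Lemma ser_tryC_before i j : committed H i -> committed H j -> pt i < pt j ->
  before (is_tryC i) (is_tryC j) ser.
Proof.
move=> com_i com_j lt_ij.
have occ l : committed H l -> occurs l H.
  by case/committed_split=> A [B ->]; rewrite /occurs has_cat /= eqxx orbT.
have [L1 [L2 [L3 EL]]] := ser_order_split2 (occ _ com_i) (occ _ com_j) lt_ij.
have com_proj l : committed H l -> exists P Q, proj C l = P ++ TryC l :: Q.
  move=> com_l; apply: committed_split; have [u [-> _ _ _]] := proj_completionE l.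
  by move: com_l; rewrite -committed_proj /committed has_cat => ->.
have [P [Q EPQ]] := com_proj i com_i; have [R [T ERT]] := com_proj j com_j.
exists (serialize L1 ++ P), (TryC i), (Q ++ serialize L2 ++ R), (TryC j),
  (T ++ serialize L3).
rewrite /= !eqxx /ser EL !(serialize_cat, serialize_cons) ERT EPQ.
by rewrite -!catA /= -?catA.
Qed.

(** [serialize L1 ++ proj A i] is what precedes the read in the serial history. The own value
    depends on the projection to [i] alone. For the closest update, [ser_point_updater] puts [l]
    into [L1], and an updater of [k] serialized between [l] and [i] would have its tryC in [A] after
    that of [l]. *)
Lemma ser_prefix L1 i L2 A op k v B : ser_order = L1 ++ i :: L2 ->
  H = A ++ Rv i op k v :: B ->
  own_value (serialize L1 ++ proj A i) i k = own_value A i k /\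
  (own_value A i k = None -> forall l, closest_update A l k v ->
   closest_update (serialize L1 ++ proj A i) l k v).
Proof.
move=> EL EH.
have := ser_order_uniq; rewrite EL cat_uniq /= => /and4P [uL1 /norP [niL1 _] _ _].
have [inL1 _] := ser_order_split EL.
split.
  rewrite own_value_proj proj_cat proj_serialize // (negPf niL1) cat0s.
  by rewrite proj_proj eqxx -own_value_proj.
move=> own_A l /closest_updateP [A1 [A2 [EA upd_l after_l ->]]].
have com_Al: committed A l by rewrite EA committed_mid.
(* [i] still reads after [A], whereas only closing events follow a tryC. *)
have ncom_Ai: ~~ committed A i.
  apply/negP=> /committed_split [D1 [D2 ED]].
  have EHi: H = D1 ++ TryC i :: D2 ++ Rv i op k v :: B by rewrite EH ED -catA.
  have := after_tryC EHi; rewrite proj_cat all_cat proj_cons /= eqxx /=.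
  by rewrite /closing /= andbF.
have ne_li: l <> i by move=> li; move: ncom_Ai; rewrite -li com_Al.
have com_prefix j : committed A j -> committed H j.
  by rewrite EH /committed has_cat => ->.
have [updA_l valA_l] := updates_prefix k EH com_Al.
have occ_l: occurs l H.
  by rewrite EH EA /occurs !has_cat /= eqxx orbT.
have lL1: l \in L1.
  rewrite inL1 occ_l /=.
  have := ser_point_updater EH own_A _ ne_li (com_prefix _ com_Al).
  by rewrite com_Al; apply; rewrite -updA_l.
have proj_L1 j : j \in L1 -> proj (serialize L1 ++ proj A i) j = proj C j.
  move=> jL1; rewrite proj_cat proj_serialize // jL1 proj_proj.
  by case: eqP jL1 niL1 => [->->|] // _ _ _; rewrite cats0.
have upd_L1 j : j \in L1 -> updates (serialize L1 ++ proj A i) j k = updates H j k.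
  move=> jL1; have [u [Ej clu _ _]] := proj_completionE j.
  by rewrite updates_proj proj_L1 // Ej updates_closing // -updates_proj.
have EHl: H = A1 ++ TryC l :: A2 ++ Rv i op k v :: B by rewrite EH EA -catA.
have [u [El clu _ _]] := proj_completionE l.
have [M1 [M2 EM]] := mem_split lL1.
(* The block of [l] is cut at its tryC; behind it come closing events, the transactions of [M2] and
   the uncommitted part of [i]. *)
apply/closest_updateP; exists (serialize M1 ++ proj A1 l),
  (proj (A2 ++ Rv i op k v :: B) l ++ u ++ serialize M2 ++ proj A i); split.
- have EHproj: proj H l = proj A1 l ++ TryC l :: proj (A2 ++ Rv i op k v :: B) l.
    by rewrite {1}EHl proj_cat proj_cons /= eqxx.
  by rewrite EM serialize_cat serialize_cons El EHproj -!catA /= -?catA.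
- by rewrite upd_L1 // -updA_l.
- move=> j; rewrite /committed !has_cat -!/(committed _ j).
  have no_tryC D : all closing D -> committed D j = false.
    by elim: D => //= e D IHD /andP [cl_e /IHD]; case: e cl_e.
  rewrite (no_tryC _ (after_tryC EHl)) (no_tryC _ clu) /=.
  have ->: committed (proj A i) j = false.
    rewrite -committed_proj proj_proj; case: eqP => // <-.
    by rewrite committed_proj (negPf ncom_Ai).
  have uM2: uniq M2 by move: uL1; rewrite EM cat_uniq /= => /and4P [].
  rewrite orbF committed_serialize // => /andP [jM2 com_j].
  have jL1: j \in L1 by rewrite EM mem_cat in_cons jM2 !orbT.
  rewrite upd_L1 //; apply/negP=> upd_j.
  have lt_lj: pt l < pt j.
    have EL': ser_order = M1 ++ l :: (M2 ++ i :: L2) by rewrite EL EM -catA.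
    have [_ /(_ j)] := ser_order_split EL'.
    by rewrite mem_cat jM2 => /esym /andP [].
  have lt_ji: pt j < pt i by move: (inL1 j); rewrite jL1 => /esym /andP [].
  have ne_ji: j <> i by move=> Eji; rewrite Eji ltnn in lt_ji.
  (* As [j] is serialized before [i], its tryC lies in [A]. Before the tryC of [l] it contradicts
     the order of the points, after it the choice of [l]. *)
  have := ser_point_updater EH own_A upd_j ne_ji com_j.
  case: ifP => [com_Aj _|_ /ltn_trans/(_ lt_ji)]; last by rewrite ltnn.
  move: (com_Aj); rewrite {1}EA /committed has_cat /= -!/(committed _ j).
  case/orP=> [/committed_split [D1 [D2 ED]]|/orP [/eqP Elj|/after_l]].
  + have EHj: H = D1 ++ TryC j :: D2 ++ TryC l :: A2 ++ Rv i op k v :: B.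
      by rewrite EHl ED -catA.
    move: lt_lj; rewrite (ser_point_tryC EHj) (ser_point_tryC EHl) ED.
    by rewrite size_cat ltnNge leq_addr.
  + by rewrite Elj ltnn in lt_lj.
  by have [-> _] := updates_prefix k EH com_Aj; rewrite upd_j.
rewrite valA_l updated_value_proj [RHS]updated_value_proj proj_L1 // El.
by rewrite updated_value_closing.
Qed.

(** The completion adds closing events only, so every read of the serial history is a read of [H],
    to which [ser_prefix] applies. *)
Lemma ser_legal : legal ser.
Proof.
move=> A' op_i op k v B' Eser.
have [L1 [i [L2 [P [Q [EL EPQ -> _]]]]]] := flatten_map_split (f := proj C) Eser.
have [u [Ei clu _ _]] := proj_completionE i.
have Eop_i: op_i = i.
  have := all_tid_proj C i.
  by rewrite EPQ all_cat /= => /and3P [_ /eqP].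
rewrite {}Eop_i {}Ei in EPQ *; have [[Q' [EH _]]|] := cat_split EPQ; last first.
  by case=> p [_ Eu]; move: clu; rewrite Eu all_cat /= /closing /= andbF.
have [A [B [EHi <- _]]] := proj_split EH.
have [-> closest] := ser_prefix EL EHi.
have := legalH EHi; case: own_value closest => // /(_ erefl) closest [l cl].
by exists l; apply: closest.
Qed.

(** Serves both conflicts that involve a read: the third clause when the update comes before the
    read, the fourth when it comes after. *)
Lemma ser_transfer A i op k v B : H = A ++ Rv i op k v :: B ->
  own_value A i k = None -> exists A' B',
  [/\ ser = A' ++ Rv i op k v :: B', own_value A' i k = None,
    forall l, closest_update A l k v -> closest_update A' l k v &
    forall j, committed H j -> pt i < pt j -> committed B' j].
Proof.
move=> EH own_A.
have occ_i: occurs i H by rewrite EH /occurs has_cat /= eqxx orbT.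
have /mem_split [L1 [L2 EL]] : i \in ser_order by rewrite mem_ser_order.
have [own_A' closest] := ser_prefix EL EH.
have [_ inL2] := ser_order_split EL.
have [u [Ei clu _ _]] := proj_completionE i.
exists (serialize L1 ++ proj A i), (proj B i ++ u ++ serialize L2); split.
- have EHproj: proj H i = proj A i ++ Rv i op k v :: proj B i.
    by rewrite {1}EH proj_cat proj_cons /= eqxx.
  by rewrite /ser EL serialize_cat serialize_cons Ei EHproj -!catA /= -?catA.
- by rewrite own_A'.
- exact: closest.
move=> j com_j lt_ij; rewrite /committed !has_cat -!/(committed _ j).
have := ser_order_uniq; rewrite EL cat_uniq /= => /and4P [_ _ _ uL2].
rewrite committed_serialize // inL2 com_j lt_ij.
have [D1 [D2 ->]] := committed_split com_j.
by rewrite /occurs has_cat /= eqxx !orbT.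
Qed.

Lemma ser_prec_conf i j : prec_conf H i j -> prec_conf ser i j.
Proof.
case=> ne_ij conf; split=> //; case: conf => [|[]].
- case=> k [upd_i [upd_j [A [e [B [f [D [EH [tryC_e tryC_f]]]]]]]]]; left.
  exists k; rewrite !updates_ser; do 2![split=> //].
  case: e EH tryC_e => //= i' EH /eqP Ei; case: f EH tryC_f => //= j' EH /eqP Ej.
  rewrite {}Ei {}Ej in EH.
  have EHj: H = (A ++ TryC i :: B) ++ TryC j :: D by rewrite EH -catA.
  apply: ser_tryC_before; rewrite ?(ser_point_tryC EH) ?(ser_point_tryC EHj).
  + by rewrite EH committed_mid.
  + by rewrite EHj committed_mid.
  by rewrite size_cat /= addnS ltnS leq_addr.
- case=> A [op [k [v [B [EH [own_A cl]]]]]]; right; left.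
  have [A' [B' [E own_A' closest _]]] := ser_transfer EH own_A.
  by exists A', op, k, v, B'; split=> //; split=> //; apply: closest.
case=> A [op [k [v [B [l [EH [own_A [cl [upd_j com_B]]]]]]]]]; right; right.
have [A' [B' [E own_A' closest after]]] := ser_transfer EH own_A.
exists A', op, k, v, B', l; rewrite updates_ser; do 3![split=> //].
  exact: closest.
split=> //; have com_j: committed H j.
  by move: com_B; rewrite EH /committed has_cat /= => ->; rewrite orbT.
apply: after => //.
have ne_ji: j <> i by move=> Eji; apply: ne_ij.
have := ser_point_updater EH own_A upd_j ne_ji com_j; case: ifP => // com_A _.
(* The remaining case is absurd: [j] would execute a tryC on both sides of the read. *)
have [A1 [A2 EA]] := committed_split com_A.
have EHj: H = A1 ++ TryC j :: A2 ++ Rv i op k v :: B by rewrite EH EA -catA.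
have := after_tryC EHj; rewrite proj_cat all_cat proj_cons => /andP [_].
have [B1 [B2 EB]] := committed_split com_B.
rewrite EB; case: ifP => _; rewrite /= ?proj_cat ?all_cat /= ?eqxx /= /closing /=.
  by rewrite ?andbF.
by rewrite ?andbF.
Qed.

Lemma ser_serial : serial ser.
Proof.
have transaction i : wf_transaction (proj ser i) /\
    (occurs i ser -> terminated ser i).
  have [u [Ei _ wfi endi]] := proj_completionE i.
  rewrite proj_ser Ei occurs_ser; split=> // /endi.
  rewrite -Ei -proj_ser /terminated => /has_split [P [e [Q [E end_e]]]].
  by have [A [B [-> _ _]]] := proj_split E; rewrite has_cat /= end_e orbT.
split=> [i|i|i j]; try by case: (transaction i).
rewrite !occurs_ser => occ_i occ_j ne_ij.
case: (ltngtP (pt i) (pt j)) => [lt|lt|/ser_point_inj eq_ij].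
- by left; apply: ser_prec_TR.
- by right; apply: ser_prec_TR.
by case: ne_ij; apply: eq_ij.
Qed.

Theorem co_opaque_serialization : co_opaque H.
Proof.
exists ser; split.
- exact: ser_serial.
- by move=> i; rewrite proj_ser.
- exact: ser_legal.
- by move=> i j /ser_point_prec_TR [*]; apply: ser_prec_TR.
exact: ser_prec_conf.
Qed.

End Serialization.

End Histories.

(** * Invariants of the algorithm *)

Section Algorithm.

Context {d : Order.disp_t} {K : orderType d} {V : Type}.
Variables (M : nat) (hash : K -> 'I_M).

Implicit Types (i j p : nat) (k : K) (hp : seq (node K V)) (s : state K V).
Implicit Types (H : history K V) (e : event K V) (l : seq (K * log_op V)).

(** * Sorted red lists and read lists *)

Definition klt (a b : node_key K) : bool :=
  match a, b with
  | HeadKey, HeadKey => false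
  | HeadKey, _ => true
  | Key k, Key k' => (k < k')%O
  | Key _, TailKey => true
  | _, _ => false
  end.

Lemma klt_trans : transitive klt.
Proof. by case=> [|b|] [|a|] [|c|] //=; apply: Order.POrderTheory.lt_trans. Qed.

Lemma klt_irr a : klt a a = false.
Proof. by case: a => //= k; apply: Order.POrderTheory.ltxx. Qed.

Lemma key_ltE (n : node K V) k : key_lt n k = klt (nkey n) (Key k).
Proof. by rewrite /key_lt; case: (nkey n). Qed.

Lemma has_keyP (n : node K V) k : reflect (nkey n = Key k) (has_key n k).
Proof.
rewrite /has_key; case: (nkey n) => [|k'|]; try by constructor.
by apply: (iffP eqP) => [->|[]].
Qed.

Local Notation key hp a := (nkey (nd hp a)).
Local Notation red hp a := (nrl (nd hp a)).

(** Paths do not continue beyond a tail. This also excludes indices outside the heap, where [nd]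
    yields [dflt_node] with key [TailKey]. *)
Inductive reach hp : nat -> nat -> Prop :=
| reach_refl a : reach hp a a
| reach_next a c : key hp a <> TailKey -> reach hp (red hp a) c -> reach hp a c.

Lemma reach_trans hp a b c : reach hp a b -> reach hp b c -> reach hp a c.
Proof. by elim=> // x y kx _ IH /IH; apply: reach_next. Qed.

Lemma reach_inv hp a c : reach hp a c -> a = c \/ reach hp (red hp a) c.
Proof. by case=> [b|b b' _]; [left | right]. Qed.

(** Strict sorting and reachability from the right bucket make a red walk for [k] end at the only
    node with key [k], if there is one; a logical deletion does not take it off the red list. The
    bound on red links keeps them away from [size hp], the index of the next new node. *)
Record heap_inv hp : Prop := HeapInv {
  head_key : forall k, key hp (bucket_head hash k) = HeadKey;
  red_sorted : forall a, key hp a <> TailKey ->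
    klt (key hp a) (key hp (red hp a)) /\ red hp a < size hp;
  red_reach : forall a k, key hp a = Key k -> reach hp (bucket_head hash k) a }.

Definition in_rvl hp k i : Prop :=
  exists a, key hp a = Key k /\ i \in nrvl (nd hp a).

Record same_links hp hp' : Prop := SameLinks {
  same_size : size hp <= size hp';
  same_key : forall a, key hp' a = key hp a;
  same_rl : forall a, red hp' a = red hp a }.

Definition same_red hp hp' : Prop :=
  same_links hp hp' /\ forall a, nrvl (nd hp' a) = nrvl (nd hp a).

Lemma same_red_trans hp1 hp2 hp3 :
  same_red hp1 hp2 -> same_red hp2 hp3 -> same_red hp1 hp3.
Proof.
case=> [[s1 k1 r1] v1] [[s2 k2 r2] v2]; split; last by move=> a; rewrite v2.
split; first exact: leq_trans s2.
- by move=> a; rewrite k2.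
by move=> a; rewrite r2.
Qed.

Lemma nd_upd hp a f b : nd (upd hp a f) b = if b == a then f (nd hp a) else nd hp b.
Proof. by rewrite /nd /upd nth_set_nth. Qed.

Lemma same_links_upd hp a f :
  (forall n, nkey (f n) = nkey n) -> (forall n, nrl (f n) = nrl n) ->
  same_links hp (upd hp a f).
Proof.
move=> fk fr; split.
- by rewrite size_set_nth leq_maxr.
- by move=> b; rewrite nd_upd; case: eqP => // ->.
by move=> b; rewrite nd_upd; case: eqP => // ->.
Qed.

Lemma same_red_upd hp a f :
  (forall n, nkey (f n) = nkey n) -> (forall n, nrvl (f n) = nrvl n) ->
  (forall n, nrl (f n) = nrl n) -> same_red hp (upd hp a f).
Proof.
move=> fk fv fr; split; first exact: same_links_upd.
by move=> b; rewrite nd_upd; case: eqP => // ->.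
Qed.

Lemma same_red_acquire i hp x hp' : acquire i hp x = Some hp' -> same_red hp hp'.
Proof.
rewrite /acquire; case: ifP => // _ [<-].
have lock g a : same_red g (upd g a (set_lock (Some i))) by apply: same_red_upd.
by do 3!apply: same_red_trans (lock _ _).
Qed.

Lemma same_red_release i hp : same_red hp (release i hp).
Proof.
have ndE a : nd (release i hp) a = nd hp a \/
    nd (release i hp) a = set_lock None (nd hp a).
  rewrite /nd /release; have [lt_a|le_a] := ltnP a (size hp).
    by rewrite (nth_map dflt_node) //; case: (nlock _) => [j|]; [case: ifP|]; auto.
  by left; rewrite !nth_default ?size_map.
by do ![split]; rewrite ?size_map // => a; case: (ndE a) => ->.
Qed.

Lemma same_links_reach hp hp' a c : same_links hp hp' -> reach hp a c -> reach hp' a c.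
Proof.
move=> same; elim=> [b|b e kb _ IH]; first exact: reach_refl.
by apply: reach_next; rewrite ?(same_key same) // (same_rl same).
Qed.

Lemma same_links_inv hp hp' : same_links hp hp' -> heap_inv hp -> heap_inv hp'.
Proof.
move=> same [hd srt rch]; split.
- by move=> k; rewrite (same_key same).
- move=> a; rewrite !(same_key same) (same_rl same) => /srt [? lt_a].
  by split=> //; apply: leq_trans lt_a (same_size same).
by move=> a k; rewrite (same_key same) => /rch; apply: same_links_reach.
Qed.

Lemma same_red_inv hp hp' : same_red hp hp' -> heap_inv hp -> heap_inv hp'.
Proof. by case=> same _; apply: same_links_inv. Qed.

Lemma same_red_in_rvl hp hp' k i : same_red hp hp' -> in_rvl hp k i -> in_rvl hp' k i.
Proof. by move=> [same rvl] [a [ka ia]]; exists a; rewrite (same_key same) rvl. Qed.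

Lemma same_links_walk hp hp' k a p c : same_links hp hp' ->
  walk (@nrl K V) hp k a p c -> walk (@nrl K V) hp' k a p c.
Proof.
move=> same; elim=> {a p c} [a|a p c].
  rewrite key_ltE => nlt; rewrite -(same_rl same); apply: walk_stop.
  by rewrite key_ltE (same_key same) (same_rl same).
rewrite key_ltE => lt _ IH; apply: walk_next; rewrite (same_rl same) //.
by rewrite key_ltE (same_key same).
Qed.

Lemma klt_not_tail a b : klt a b -> a <> TailKey.
Proof. by case: a. Qed.

Lemma walk_pred hp k a p c : walk (@nrl K V) hp k a p c ->
  klt (key hp a) (Key k) ->
  [/\ klt (key hp p) (Key k), c = red hp p, ~~ klt (key hp c) (Key k) &
    reach hp a p].
Proof.
elim=> {a p c} [a|a p c].
  by rewrite key_ltE => nlt lt; split=> //; apply: reach_refl.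
rewrite key_ltE => lt _ /(_ lt) [lt_p -> nlt rch] lt_a; split=> //.
by apply: reach_next => //; apply: klt_not_tail lt_a.
Qed.

Lemma reach_klt hp a c k : heap_inv hp -> reach hp a c -> key hp c = Key k ->
  a = c \/ klt (key hp a) (Key k).
Proof.
move=> inv; elim=> [|{}a {}c ka _ IH] kc; first by left.
right; have [lt _] := red_sorted inv ka.
by case: (IH kc) => [E|lt2]; [rewrite -kc -E | apply: klt_trans lt2].
Qed.

(** The walk and the path to [b] follow the same links. The walk cannot stop early, because all keys
    before [b] are below [k], and it cannot pass [b], whose key is not. *)
Lemma walk_hits hp k a p c b : heap_inv hp ->
  walk (@nrl K V) hp k a p c -> klt (key hp a) (Key k) ->
  key hp b = Key k -> reach hp a b -> c = b.
Proof.
move=> inv wk lt_a kb rch; elim: wk lt_a rch => {a p c} [a nlt|a p c lt _ IH] lt_a.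
  case/reach_inv=> [Eab|rch]; first by rewrite Eab kb klt_irr in lt_a.
  case: (reach_klt inv rch kb) => // lt.
  by rewrite key_ltE lt in nlt.
case/reach_inv=> [Eab|rch]; first by rewrite Eab kb klt_irr in lt_a.
by apply: IH; rewrite -?key_ltE.
Qed.

Local Notation red_walk hp k p c :=
  (walk (@nrl K V) hp k (bucket_head hash k) p c).

Lemma red_walk_hits hp k p c b : heap_inv hp -> red_walk hp k p c ->
  key hp b = Key k -> c = b.
Proof.
move=> inv wk kb; apply: walk_hits wk _ kb (red_reach inv kb) => //.
by rewrite (head_key inv).
Qed.

Lemma insert_inv hp hp' k p c : heap_inv hp -> red_walk hp k p c ->
  ~~ has_key (nd hp c) k -> size hp < size hp' ->
  (forall a, a != size hp -> key hp' a = key hp a) ->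
  key hp' (size hp) = Key k ->
  red hp' (size hp) = c -> red hp' p = size hp ->
  (forall a, a != size hp -> a != p -> red hp' a = red hp a) ->
  heap_inv hp'.
Proof.
move=> inv wk nk lt_sz keyE keyN redN redP redE.
have lt_head: klt (key hp (bucket_head hash k)) (Key k) by rewrite (head_key inv).
have [lt_p Ec nlt_c rch_p] := walk_pred wk lt_head.
(* Outside the heap [nd] returns the default node, which counts as a tail. *)
have in_range a : key hp a <> TailKey -> a != size hp.
  by move=> ka; apply/eqP=> Ea; apply: ka; rewrite Ea /nd nth_default.
have p_sz: p != size hp by apply: in_range; apply: klt_not_tail lt_p.
have lt_c: c < size hp.
  by have [_] := red_sorted inv (klt_not_tail lt_p); rewrite -Ec.
have c_sz: c != size hp by rewrite neq_ltn lt_c.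
(* Old paths survive: the link out of [p] becomes a detour through the new node. *)
have rch a b : reach hp a b -> reach hp' a b.
  elim=> [x|x y kx _ IH]; first exact: reach_refl.
  have [xp|xp] := eqVneq x p.
    rewrite xp in kx IH *; apply: reach_next; first by rewrite keyE.
    by rewrite redP; apply: reach_next; [rewrite keyN | rewrite redN Ec].
  by apply: reach_next; rewrite ?keyE ?redE //; apply: in_range.
split.
- by move=> k'; rewrite keyE ?(head_key inv) // in_range // (head_key inv).
- move=> a; have [->|a_sz] := eqVneq a (size hp).
    rewrite keyN redN keyE // => _; split; last exact: ltn_trans lt_c lt_sz.
    (* The key of [c] is neither below [k] nor equal to it, hence above. *)
    move: nlt_c nk; rewrite /has_key; case: (key hp c) => //= k'.
    rewrite -Order.TotalTheory.leNgt Order.POrderTheory.le_eqVlt.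
    by case/orP=> [/eqP ->|//]; rewrite eqxx.
  rewrite keyE // => ka; have [ap|ap] := eqVneq a p.
    by rewrite ap redP keyN.
  have [lt_a in_a] := red_sorted inv ka.
  by rewrite redE // keyE ?neq_ltn ?in_a //; split=> //; apply: ltn_trans lt_sz.
move=> a k'; have [->|a_sz] := eqVneq a (size hp); last first.
  by rewrite keyE // => /(red_reach inv) /rch.
rewrite keyN => -[<-]; apply: reach_trans (rch _ _ rch_p) _.
apply: reach_next; first by rewrite keyE //; apply: klt_not_tail lt_p.
by rewrite redP; apply: reach_refl.
Qed.

Lemma nd_rcons hp n a :
  nd (rcons hp n) a = if a == size hp then n else nd hp a.
Proof.
rewrite /nd nth_rcons; case: ltngtP => // lt_a.
by rewrite nth_default // ltnW.
Qed.

(** Common to the marked node that an rv-method creates and the unmarked node of an insert. *)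
Lemma link_node_inv hp k p c n : heap_inv hp -> red_walk hp k p c ->
  ~~ has_key (nd hp c) k -> nkey n = Key k -> nrl n = c ->
  let hp' := upd (rcons hp n) p (set_rl (size hp)) in
  [/\ heap_inv hp', nd hp' (size hp) = n &
    forall k' j, in_rvl hp k' j -> in_rvl hp' k' j].
Proof.
move=> inv wk nk kn rn hp'.
have lt_head: klt (key hp (bucket_head hash k)) (Key k) by rewrite (head_key inv).
have [lt_p _ _ _] := walk_pred wk lt_head.
have p_sz: p != size hp.
  by apply/eqP=> Ep; apply: (klt_not_tail lt_p); rewrite Ep /nd nth_default.
have ndN: nd hp' (size hp) = n by rewrite nd_upd eq_sym (negPf p_sz) nd_rcons eqxx.
have ndE a : a != size hp -> nd hp' a = if a == p then set_rl (size hp) (nd hp a)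
                                        else nd hp a.
  by move=> /negPf na; rewrite nd_upd !nd_rcons na (negPf p_sz); case: eqP => // ->.
split=> //.
- apply: (@insert_inv hp hp' k p c) => //; rewrite ?ndN //.
  + by rewrite size_set_nth size_rcons leq_max leqnn orbT.
  + by move=> a na; rewrite ndE //; case: ifP.
  + by rewrite nd_upd eqxx.
  by move=> a na /negPf np; rewrite ndE // np.
move=> k' j [a [ka ja]]; exists a.
have na: a != size hp by apply/eqP=> Ea; move: ka; rewrite Ea /nd nth_default.
by rewrite ndE //; case: ifP.
Qed.

Lemma in_rvl_upd hp a f k i : (forall n, nkey (f n) = nkey n) ->
  key hp a <> Key k -> in_rvl hp k i -> in_rvl (upd hp a f) k i.
Proof.
move=> fk ka [b [kb ib]]; exists b; rewrite nd_upd.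
by case: eqP ka => // <-.
Qed.

Lemma rv_access_inv i hp k x : heap_inv hp -> red_walk hp k (rpred x) (rcurr x) ->
  [/\ heap_inv (rv_access i hp k x), in_rvl (rv_access i hp k x) k i &
    forall k' j, in_rvl hp k' j -> in_rvl (rv_access i hp k x) k' j].
Proof.
move=> inv wk; rewrite /rv_access /node_exists.
case: ifP => [/has_keyP kc|/negbT nk]; last first.
  have [inv' ndN rvl'] := link_node_inv (n := Node (Key k) None None true [:: i]
    (rcurr x) (bcurr x)) inv wk nk erefl erefl.
  by split=> //; exists (size hp); rewrite ndN /= mem_head.
split.
- by apply: same_links_inv inv; apply: same_links_upd.
- by exists (rcurr x); rewrite nd_upd eqxx /= mem_rcons mem_head.
move=> k' j [a [ka ja]]; exists a; rewrite nd_upd.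
by case: eqP ka ja => // -> ka ja; rewrite /= mem_rcons in_cons ja orbT.
Qed.

(** The key [k] is excepted because its read list may be emptied; the validation has already dealt
    with its readers. *)
Lemma apply_update_inv hp k o x : heap_inv hp -> red_walk hp k (rpred x) (rcurr x) ->
  heap_inv (apply_update hp k o x) /\
  forall k' j, k' != k -> in_rvl hp k' j -> in_rvl (apply_update hp k o x) k' j.
Proof.
move=> inv wk; have bl g a b : same_red g (upd g a (set_bl b)).
  exact: same_red_upd.
have bl_inv g a b : heap_inv g -> heap_inv (upd g a (set_bl b)).
  exact: same_red_inv.
have bl_rvl g a b k' j : in_rvl g k' j -> in_rvl (upd g a (set_bl b)) k' j.
  exact: same_red_in_rvl.
have present f : has_key (nd hp (rcurr x)) k ->
    (forall n, nkey (f n) = nkey n) -> (forall n, nrl (f n) = nrl n) ->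
    heap_inv (upd hp (rcurr x) f) /\
    forall k' j, k' != k -> in_rvl hp k' j -> in_rvl (upd hp (rcurr x) f) k' j.
  move=> /has_keyP kc fk fr; split.
    by apply: same_links_inv inv; apply: same_links_upd.
  move=> k' j /eqP ne; apply: in_rvl_upd => //.
  by rewrite kc => -[E]; apply: ne.
case: o => [w|v|]; rewrite /= /apply_insert /apply_delete /node_exists //.
  case: ifP => [kc|/negbT nk].
    have [//|//|inv' rvl'] := present (revive (Some v)) kc.
    case: ifP => _; split; auto.
  have [inv' _ rvl'] := link_node_inv (n := Node (Key k) (Some v) None false [::]
    (rcurr x) (bcurr x)) inv wk nk erefl erefl.
  by split; auto.
case: ifP => // kc.
have [//|//|inv' rvl'] := present (@delete_node d K V) kc.
by case: ifP => _; split; auto.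
Qed.

Lemma apply_updates_inv hp l hp' : apply_updates hash hp l hp' -> heap_inv hp ->
  heap_inv hp' /\
  forall k j, k \notin map fst l -> in_rvl hp k j -> in_rvl hp' k j.
Proof.
elim=> {hp l hp'} [//|hp k o l x hp' [_ wk] _ IH] inv.
have [inv1 rvl1] := apply_update_inv o inv wk.
have [inv2 rvl2] := IH inv1; split=> // k' j.
by rewrite in_cons negb_or => /andP [ne ni] /(rvl1 _ _ ne) /(rvl2 _ _ ni).
Qed.

Lemma locked_red i hp k x hp' : Defs.locked hash i hp k x hp' -> heap_inv hp ->
  [/\ same_red hp hp', heap_inv hp' & red_walk hp' k (rpred x) (rcurr x)].
Proof.
case=> [[_ wk] /same_red_acquire same _] inv; split=> //.
  exact: same_red_inv inv.
by case: same => same _; apply: same_links_walk wk.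
Qed.

(** * Effect of the validation *)

Implicit Types (tx : nat -> trans K V).

Lemma check_rvl_spec tx i r tx' : check_rvl tx i r = Some tx' ->
  forall p, tx' p = if (p \in r) && (p != i) then set_status SFalse (tx p) else tx p.
Proof.
rewrite /check_rvl; case: ifP => // _ [<-] p.
by rewrite mem_filter andbC.
Qed.

Lemma tryC_check_spec hp tx i k x tx' : tryC_check hp tx i k x = Some tx' ->
  forall p, tx' p = tx p \/ p <> i /\ tx' p = set_status SFalse (tx p).
Proof.
rewrite /tryC_check; case: ifP => _; last by move=> [<-]; left.
move/check_rvl_spec=> E p; rewrite E.
by case: ifP => [/andP [_ /eqP]|]; [right | left].
Qed.

Record tx_killed i tx tx' : Prop := TxKilled {
  killed_log : forall p, log (tx' p) = log (tx p);
  killed_phase : forall p, phase (tx' p) = phase (tx p);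
  killed_status : forall p,
    status (tx' p) = status (tx p) \/ p <> i /\ status (tx' p) = SFalse }.

Lemma tryC_validation_spec i hp tx l hp' tx' b :
  tryC_validation hash i hp tx l hp' tx' b -> heap_inv hp ->
  [/\ same_red hp hp', tx_killed i tx tx' &
    b -> forall k p, k \in map fst l -> in_rvl hp k p -> p <> i ->
      status (tx' p) = SFalse].
Proof.
elim=> {hp tx l hp' tx' b}.
- by move=> hp tx _; split=> //; split=> //; left.
- move=> hp tx k o l x hp1 lck _ inv; have [same _ _] := locked_red lck inv.
  by split=> //; split=> //; left.
move=> hp tx k o l x hp1 tx1 hp2 tx2 b lck chk _ IH inv.
have [same inv1 wk] := locked_red lck inv.
have [same2 [log2 phase2 status2] kill2] := IH inv1.
have spec := tryC_check_spec chk; split.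
- exact: same_red_trans same2.
- split=> p.
  + by rewrite log2; case: (spec p) => [->|[_ ->]].
  + by rewrite phase2; case: (spec p) => [->|[_ ->]].
  case: (status2 p) => [->|]; last by right.
  by case: (spec p) => [->|[ne ->]]; [left | right].
move=> b_true k' p; rewrite in_cons => /orP [/eqP -> rvl ne|kl rvl ne]; last first.
  by apply: kill2 kl _ ne => //; apply: same_red_in_rvl rvl.
(* A status set to false for this key stays false while later keys are validated. *)
suff E: status (tx1 p) = SFalse by case: (status2 p) => [->|[]].
have [a [ka pa]] := same_red_in_rvl same rvl.
(* The located node is the very node whose read list contains [p]. *)
have Ea: rcurr x = a by apply: red_walk_hits wk ka.
move: chk; rewrite /tryC_check /node_exists Ea (introT (has_keyP _ _) ka).
by move/check_rvl_spec=> ->; rewrite pa; move/eqP: ne => ->.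
Qed.

Lemma log_get_set l k o k' :
  log_get (log_set l k o) k' = if k' == k then Some o else log_get l k'.
Proof.
rewrite /log_get /log_set /= eq_sym; case: eqP => //= ne.
congr (ohead (map _ _)); rewrite -filter_predI; apply: eq_filter => e /=.
by case: eqP => //= ->; apply/eqP=> E; apply: ne.
Qed.

Lemma log_updates_mem l k o :
  log_get l k = Some o -> is_update o -> k \in map fst (log_updates l).
Proof.
move=> get upd_o.
have: has (fun e : K * log_op V => e.1 == k) [seq e <- l | is_update e.2].
  elim: l get => //= -[k' o'] l IHl; rewrite /log_get /=.
  case: eqP => [->|ne] /=; first by case=> ->; rewrite upd_o /= eqxx.
  by move/IHl; case: ifP => //= _ ->; rewrite orbT.
(* [V] carries no decidable equality, so membership of pairs is expressed by counting, which sorting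
   preserves. *)
rewrite has_count -(count_sort (fun e f : K * log_op V => (e.1 <= f.1)%O)) -has_count.
rewrite -/(log_updates l); elim: (log_updates l) => //= e r IHr.
by rewrite in_cons eq_sym => /orP [->|/IHr ->]; rewrite ?orbT.
Qed.

Lemma init_heap_nd a : nd (@init_heap d K V M) a =
  if a < M.*2 then
    Node (if odd a then TailKey else HeadKey) None None false [::]
      a./2.*2.+1 a./2.*2.+1
  else dflt_node.
Proof.
pose nodes b : seq (node K V) :=
  [:: Node HeadKey None None false [::] b.*2.+1 b.*2.+1;
      Node TailKey None None false [::] b.*2.+1 b.*2.+1].
suff nodesE m n c : nth dflt_node (flatten [seq nodes b | b <- iota m n]) c =
    if c < n.*2 then
      Node (if odd c then TailKey else HeadKey) None None false [::]
        (m + c./2).*2.+1 (m + c./2).*2.+1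
    else dflt_node by rewrite /nd /init_heap nodesE add0n.
elim: n m c => [|n IHn] m c; first by rewrite nth_nil.
case: c => [|[|c]] /=; rewrite ?addn0 //.
by rewrite IHn negbK doubleS !ltnS addSnnS.
Qed.

Lemma init_heap_inv : heap_inv (@init_heap d K V M).
Proof.
have sz: size (@init_heap d K V M) = M.*2.
  rewrite /init_heap; suff: forall m n, size (flatten [seq
    [:: Node HeadKey None None false [::] b.*2.+1 b.*2.+1;
        Node TailKey None None false [::] b.*2.+1 b.*2.+1 : node K V]
    | b <- iota m n]) = n.*2 by [].
  by move=> m n; elim: n m => //= n IHn m; rewrite IHn doubleS.
split.
- by move=> k; rewrite init_heap_nd /bucket_head ltn_double ltn_ord odd_double.
- move=> a; have := init_heap_nd a.
  case: ifP => [lt_a|_ -> //]; case: ifP => [_ -> //|even_a -> _].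
  have Ea: a./2.*2 = a by rewrite -[RHS]odd_double_half even_a.
  have lt_aM: a./2 < M by rewrite -ltn_double Ea.
  have ltS: a./2.*2.+1 < M.*2.
    by rewrite -doubleS leq_double.
  by rewrite [nrl _]/= (init_heap_nd _.+1) sz ltS [odd _]/= odd_double.
by move=> a k; rewrite init_heap_nd; do 2?case: ifP.
Qed.

(** * Invariant of executions *)

Definition body_event e : bool :=
  match e with Insert _ _ _ | Rv _ _ _ _ => true | _ => false end.

(** The exact shape is kept as long as events may still be appended; for a finished transaction
    well-formedness is enough. *)
Definition phase_inv (f : tx_phase) i (h : history K V) : Prop :=
  match f with
  | Idle => h = [::]
  | Running => exists2 b, h = Begin i :: b & all body_event b
  | Effected => exists2 b, h = Begin i :: rcons b (TryC i) & all body_event b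
  | Committed | Aborted => wf_transaction h
  end.

Lemma wf_body_cat (b h : history K V) :
  all body_event b -> wf_body (b ++ h) = wf_body h.
Proof. by elim: b => //= e b IHb /andP [be /IHb]; case: e be. Qed.

Lemma phase_inv_wf f i h : phase_inv f i h -> wf_transaction h.
Proof.
case: f => //= [->//|[b -> bb]|[b -> bb]] /=.
  by rewrite -[b]cats0 wf_body_cat.
by rewrite -cats1 wf_body_cat.
Qed.

(** [log_own] recognizes in the history which answers come from the log; [log_upd] ensures that the
    validation visits every key the transaction updates. *)
Record log_inv H i l : Prop := LogInv {
  log_own : forall k, isSome (log_get l k) = isSome (own_value H i k);
  log_upd : forall k, updates H i k -> oapp (@is_update V) false (log_get l k) }.

(** [inv_rvl] makes [inv_doomed] inductive: at the tryC that dooms a reader, the reader is already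
    false or is found in the read list. [inv_idle] makes the timestamp drawn by a begin fresh. *)
Record exec_inv H s : Prop := ExecInv {
  inv_heap : heap_inv (heap s);
  inv_counter : 0 < gcounter s;
  inv_phase : forall i, phase_inv (phase (txs s i)) i (proj H i);
  inv_idle : forall i, gcounter s <= i -> phase (txs s i) = Idle;
  inv_log : forall i, phase (txs s i) = Running -> log_inv H i (log (txs s i));
  inv_rvl : forall i k, shared_rv H i k ->
    [\/ status (txs s i) = SFalse, committed H i | in_rvl (heap s) k i];
  inv_doomed : forall i, doomed H i -> status (txs s i) = SFalse }.

Lemma shared_rv_rcons H e i k : shared_rv (rcons H e) i k ->
  shared_rv H i k \/ exists op v, e = Rv i op k v /\ own_value H i k = None.
Proof.
case=> A [op [v [B []]]]; case/lastP: B => [|B f].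
  by rewrite cats1 => /rcons_inj [-> ->]; right; exists op, v.
by rewrite -rcons_cons -rcons_cat => /rcons_inj [-> _] own; left; exists A, op, v, B.
Qed.

Lemma doomed_rcons H e i : doomed (rcons H e) i -> doomed H i \/
  exists j k, [/\ e = TryC j, shared_rv H i k, updates H j k, j <> i & ~~ committed H i].
Proof.
case=> A [j [B [k []]]]; case/lastP: B => [|B f].
  by rewrite cats1 => /rcons_inj [-> ->] *; right; exists j, k.
rewrite -rcons_cons -rcons_cat => /rcons_inj [-> _] *.
by left; exists A, j, B, k.
Qed.

Lemma shared_rv_occurs H i k : shared_rv H i k -> proj H i <> [::].
Proof.
case=> A [op [v [B [-> _]]]]; rewrite proj_cat proj_cons /= eqxx.
by case: (proj A i).
Qed.

Lemma doomed_occurs H i : doomed H i -> proj H i <> [::].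
Proof.
case=> A [j [B [k [-> rv _ _ _]]]]; rewrite proj_cat.
by case: (proj A i) (shared_rv_occurs rv).
Qed.

Lemma updates_rcons_other H e i k :
  tid e != i -> updates (rcons H e) i k = updates H i k.
Proof.
by move=> ne; rewrite updates_proj proj_rcons (negPf ne) -updates_proj.
Qed.

Lemma own_value_rcons_other H e i k :
  tid e != i -> own_value (rcons H e) i k = own_value H i k.
Proof.
by move=> ne; rewrite own_value_proj proj_rcons (negPf ne) -own_value_proj.
Qed.

Lemma log_inv_rcons_other H e i l :
  tid e != i -> log_inv H i l -> log_inv (rcons H e) i l.
Proof.
move=> ne [own upd]; split=> k; first by rewrite own_value_rcons_other.
by rewrite updates_rcons_other //; apply: upd.
Qed.

Lemma committed_rcons H e i : committed H i -> committed (rcons H e) i.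
Proof. by rewrite /committed has_rcons => ->; rewrite orbT. Qed.

Lemma own_value_rcons H e i k : own_value (rcons H e) i k =
  match e with
  | Insert j k' v => if (j == i) && (k' == k) then Some (Some v) else own_value H i k
  | Rv j Lookup k' v => if (j == i) && (k' == k) then Some v else own_value H i k
  | Rv j Delete k' _ => if (j == i) && (k' == k) then Some None else own_value H i k
  | _ => own_value H i k
  end.
Proof. by rewrite /own_value foldl_rcons. Qed.

Lemma updates_rcons H e i k : updates (rcons H e) i k =
  match e with
  | Insert j k' _ | Rv j Delete k' _ => (j == i) && (k' == k)
  | _ => false
  end || updates H i k.
Proof. by rewrite /updates has_rcons orbCA. Qed.

(** All that the invariant needs to know about a step, whatever its rule. [eff_status] excepts idle
    transactions because a begin sets the status anew; the nonempty projection in [eff_anchor]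
    excepts the begin, which is an anchor. *)
Record step_effect H s e s' : Prop := StepEffect {
  eff_heap : heap_inv (heap s');
  eff_counter : gcounter s <= gcounter s' /\ tid e < gcounter s';
  eff_other : forall j, j != tid e ->
    phase (txs s' j) = phase (txs s j) /\ log (txs s' j) = log (txs s j);
  eff_status : forall j, phase (txs s j) <> Idle ->
    status (txs s j) = SFalse -> status (txs s' j) = SFalse;
  eff_rvl : forall k j, in_rvl (heap s) k j ->
    [\/ in_rvl (heap s') k j, e = TryC j | status (txs s' j) = SFalse];
  eff_shared : forall op k v, e = Rv (tid e) op k v ->
    own_value H (tid e) k = None -> in_rvl (heap s') k (tid e);
  eff_kill : forall k j, e = TryC (tid e) -> updates H (tid e) k ->
    in_rvl (heap s) k j -> j <> tid e -> status (txs s' j) = SFalse;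
  eff_self : phase_inv (phase (txs s' (tid e))) (tid e) (rcons (proj H (tid e)) e);
  eff_log : phase (txs s' (tid e)) = Running ->
    log_inv (rcons H e) (tid e) (log (txs s' (tid e)));
  eff_anchor : status (txs s (tid e)) = SFalse -> proj H (tid e) <> [::] ->
    ~~ anchor H e (tid e) }.

Lemma idle_proj H s i : exec_inv H s -> phase (txs s i) = Idle -> proj H i = [::].
Proof. by move=> inv idle; have := inv_phase inv i; rewrite idle. Qed.

Lemma counter_gt H s i : exec_inv H s -> phase (txs s i) <> Idle -> i < gcounter s.
Proof. by move=> inv ph; rewrite ltnNge; apply/negP=> /(inv_idle inv). Qed.

Lemma begin_effect H s first : exec_inv H s ->
  step_effect H s (Begin (gcounter s)) (start s first).
Proof.
move=> inv; have idle := inv_idle inv (leqnn _).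
have proj0 := idle_proj inv idle.
split=> //=.
- exact: inv_heap inv.
- by move=> j /negPf ne; rewrite /upd_tx ne.
- by move=> j; rewrite /upd_tx; case: eqP => // ->; rewrite idle.
- by move=> k j; constructor.
- by rewrite /upd_tx eqxx proj0; exists [::].
move=> _; rewrite /upd_tx eqxx; split=> k /=.
  by rewrite own_value_rcons own_value_proj proj0.
(* Only timestamp 0 updates keys without events, and the counter is positive. *)
rewrite updates_rcons updates_proj proj0 /updates orbF => /eqP g0.
by have := inv_counter inv; rewrite g0.
Qed.

(** Covers every rule except the begins and the successful tryC: no read list shrinks. *)
Lemma running_effect H s e hp tx f : exec_inv H s ->
  phase (txs s (tid e)) <> Idle ->
  (forall j, e <> TryC j) ->
  heap_inv hp -> (forall k j, in_rvl (heap s) k j -> in_rvl hp k j) ->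
  tx_killed (tid e) (txs s) tx -> (forall t, status (f t) = status t) ->
  (forall op k v, e = Rv (tid e) op k v -> own_value H (tid e) k = None ->
    in_rvl hp k (tid e)) ->
  phase_inv (phase (f (tx (tid e)))) (tid e) (rcons (proj H (tid e)) e) ->
  (phase (f (tx (tid e))) = Running ->
    log_inv (rcons H e) (tid e) (log (f (tx (tid e))))) ->
  (status (txs s (tid e)) = SFalse -> ~~ anchor H e (tid e)) ->
  step_effect H s e (State (gcounter s) hp (upd_tx tx (tid e) f)).
Proof.
move=> inv ph nC hp_inv rvl kill stf shared self logi anc.
split=> //=; rewrite ?/upd_tx ?eqxx //.
- by split=> //; apply: counter_gt inv ph.
- by move=> j /negPf ->; rewrite (killed_log kill) (killed_phase kill).
- move=> j _ st; have: status (tx j) = SFalse.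
    by case: (killed_status kill j) => [->|[]].
  by case: ifP => // _; rewrite stf.
- by move=> k j /rvl; constructor.
- by move=> k j /nC.
by move=> /anc.
Qed.

Lemma tx_killed_refl i tx : tx_killed i tx tx.
Proof. by split=> // p; left. Qed.

Lemma running_proj H s i : exec_inv H s -> phase (txs s i) = Running ->
  exists2 b, proj H i = Begin i :: b & all body_event b.
Proof. by move=> inv ph; have := inv_phase inv i; rewrite ph. Qed.

Lemma running_body H s e : exec_inv H s -> phase (txs s (tid e)) = Running ->
  body_event e -> phase_inv Running (tid e) (rcons (proj H (tid e)) e).
Proof.
move=> inv ph be; have [b -> bb] := running_proj inv ph.
by exists (rcons b e); rewrite ?all_rcons ?be.
Qed.

Lemma running_abort H s i c : exec_inv H s -> phase (txs s i) = Running ->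
  wf_transaction (rcons (proj H i) (Abort i c)).
Proof.
move=> inv ph; have [b -> bb] := running_proj inv ph.
by rewrite rcons_cons -cats1 /= wf_body_cat.
Qed.

Lemma abort_effect H s i c : exec_inv H s -> phase (txs s i) = Running ->
  step_effect H s (Abort i c)
    (State (gcounter s) (heap s) (upd_tx (txs s) i (set_phase Aborted))).
Proof.
move=> inv ph; apply: running_effect => //=.
- by rewrite ph.
- exact: inv_heap inv.
- exact: tx_killed_refl.
exact: running_abort ph.
Qed.

Lemma step_effectP H s e s' : exec_inv H s -> step hash s e s' -> step_effect H s e s'.
Proof.
move=> inv st; case: st inv => {s e s'} /=.
- by move=> s inv; apply: begin_effect.
- by move=> s first _ inv; apply: begin_effect.
- move=> s i k v ph inv; apply: running_effect => //=.
  + by rewrite ph.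
  + exact: inv_heap inv.
  + exact: tx_killed_refl.
  + by rewrite ph; apply: (@running_body _ _ (Insert i k v) inv).
  move=> _; have [own upd] := inv_log inv ph.
  split=> k'; rewrite log_get_set ?own_value_rcons ?updates_rcons eqxx /=.
    by rewrite eq_sym; case: eqP.
  by rewrite eq_sym; case: eqP => //= _; apply: upd.
- move=> s i op k o ph get inv; have [own upd] := inv_log inv ph.
  have own_k: isSome (own_value H i k) by rewrite -own get.
  apply: running_effect => //=.
  + by rewrite ph.
  + exact: inv_heap inv.
  + exact: tx_killed_refl.
  + by move=> op' k' v [_ <- _] E; rewrite E in own_k.
  + by rewrite ph; apply: (@running_body _ _ (Rv i op k _) inv).
  + move=> _; split=> k'; rewrite ?own_value_rcons ?updates_rcons eqxx /=.
      case: op => /=; first by case: eqP => [<-|]; rewrite ?get.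
      by rewrite log_get_set eq_sym; case: eqP.
    case: op => /=; first exact: upd.
    by rewrite log_get_set eq_sym; case: eqP => //= _; apply: upd.
  by rewrite eqxx /= own_k.
- by move=> s i op k ph _ _ inv; apply: abort_effect.
- move=> s i op k x hp ph get st lck inv; have [own upd] := inv_log inv ph.
  have [same inv1 wk] := locked_red lck (inv_heap inv).
  have [inv2 rvl_i rvl2] := rv_access_inv i inv1 wk.
  have rel := same_red_release i (rv_access i hp k x).
  apply: running_effect => //=.
  + by rewrite ph.
  + exact: same_red_inv rel inv2.
  + move=> k' j rvl; apply: same_red_in_rvl rel _; apply: rvl2.
    exact: same_red_in_rvl same rvl.
  + exact: tx_killed_refl.
  + by move=> op' k' v [_ <- _] _; apply: same_red_in_rvl rel _.
  + by rewrite ph; apply: (@running_body _ _ (Rv i op k _) inv).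
  move=> _; split=> k'; rewrite log_get_set ?own_value_rcons ?updates_rcons eqxx /=.
    by rewrite eq_sym; case: op => /=; case: eqP.
  rewrite eq_sym; case: op => /=; last by case: eqP => //= _; apply: upd.
  by case: eqP => [-> /upd|_]; [rewrite get | apply: upd].
- by move=> s i ph inv; apply: abort_effect.
- by move=> s i ph _ inv; apply: abort_effect.
- move=> s i hp tx ph st val inv.
  have [same kill _] := tryC_validation_spec val (inv_heap inv).
  have rel := same_red_trans same (same_red_release i hp).
  apply: running_effect => //=.
  + by rewrite ph.
  + exact: same_red_inv rel (inv_heap inv).
  + by move=> k j; apply: same_red_in_rvl.
  exact: running_abort ph.
- move=> s i hp tx hp' ph st val app inv; have [own upd] := inv_log inv ph.
  have [same kill killed] := tryC_validation_spec val (inv_heap inv).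
  have [inv2 rvl2] := apply_updates_inv app (same_red_inv same (inv_heap inv)).
  have rel := same_red_release i hp'.
  split=> //=; rewrite ?/upd_tx ?eqxx //.
  + exact: same_red_inv rel inv2.
  + by split=> //; apply: counter_gt inv _; rewrite ph.
  + by move=> j /negPf ->; rewrite (killed_log kill) (killed_phase kill).
  + move=> j _ st_j; case: eqP st_j => [->//|_ st_j].
    by case: (killed_status kill j) => [->|[]].
  + move=> k j rvl; have [->|ne] := eqVneq j i; first by constructor.
    (* A reader of an updated key has been set to false by the validation; the read lists of the
       other keys are intact. *)
    have [kl|nkl] := boolP (k \in map fst (log_updates (log (txs s i)))).
      by constructor 3; apply: killed kl rvl _ => //; apply/eqP.
    constructor; apply: same_red_in_rvl rel _; apply: rvl2 => //.
    exact: same_red_in_rvl same rvl.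
  + move=> k j _ /upd; case get: (log_get _ k) => [o|//] /= upd_o rvl ne.
    case: eqP => // _; apply: killed (log_updates_mem get upd_o) rvl ne.
    by [].
  have [b -> bb] := running_proj inv ph.
  by exists b.
move=> s i ph inv; apply: running_effect => //=.
- by rewrite ph.
- exact: inv_heap inv.
- exact: tx_killed_refl.
have := inv_phase inv i; rewrite ph => -[b -> bb].
by rewrite rcons_cons -!cats1 -catA /= wf_body_cat.
Qed.

Lemma step_inv H s e s' : exec_inv H s -> step hash s e s' -> exec_inv (rcons H e) s'.
Proof.
move=> inv /(step_effectP inv) eff.
have [le_g lt_e] := eff_counter eff.
have persist i : proj H i <> [::] -> status (txs s i) = SFalse ->
    status (txs s' i) = SFalse.
  by move=> occ; apply: (eff_status eff) => /(idle_proj inv).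
split.
- exact: eff_heap eff.
- exact: leq_trans (inv_counter inv) le_g.
- move=> i; rewrite proj_rcons eq_sym; have [->|ne] := eqVneq i (tid e).
    exact: eff_self eff.
  by have [-> _] := eff_other eff ne; apply: inv_phase inv i.
- move=> i le_i; have ne: i != tid e by rewrite neq_ltn (leq_trans lt_e le_i) orbT.
  have [-> _] := eff_other eff ne; apply: inv_idle inv _ _.
  exact: leq_trans le_i.
- move=> i; have [->|ne] := eqVneq i (tid e); first exact: eff_log eff.
  have [-> ->] := eff_other eff ne; move/(inv_log inv).
  by apply: log_inv_rcons_other; rewrite eq_sym.
- move=> i k /shared_rv_rcons [rv|[op [v [Ee own]]]]; last first.
    have Ei: tid e = i by rewrite Ee.
    constructor 3; move: own; rewrite -Ei; apply: (eff_shared eff (op := op) (v := v)).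
    by rewrite Ei.
  case: (inv_rvl inv rv) => [st|com|rvl].
  + by constructor; apply: persist st; apply: shared_rv_occurs rv.
  + by constructor 2; apply: committed_rcons.
  case: (eff_rvl eff rvl) => [rvl'|->|st]; [by constructor 3 | | by constructor].
  by constructor 2; rewrite -cats1 committed_mid.
move=> i /doomed_rcons [dm|[j [k [Ee rv upd ne ncom]]]].
  by apply: persist (inv_doomed inv dm); apply: doomed_occurs dm.
have Ej: tid e = j by rewrite Ee.
(* The transaction becomes doomed at this very step: it is already false, or it is in the read list
   and the validation makes it so. *)
case: (inv_rvl inv rv) => [st|com|rvl].
- by apply: persist st; apply: shared_rv_occurs rv.
- by rewrite com in ncom.
by apply: (eff_kill eff _ _ rvl); rewrite Ej //; apply/nesym.
Qed.

Lemma init_inv : exec_inv [:: Begin 0; TryC 0; Commit 0] (init_state M).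
Proof.
have no_rv i k : ~ shared_rv ([:: Begin 0; TryC 0; Commit 0] : history K V) i k.
  by case=> A [op [v [B [E _]]]]; move: E; case: A => [|? [|? [|? []]]].
split=> //=.
- exact: init_heap_inv.
- by case=> [|i] //=.
- by case.
- by case.
- by move=> i k /no_rv.
move=> i [A [j [B [k [E [A' [op [v [B' [EA own]]]]] _ _ _]]]]].
by case: (no_rv i k); exists A', op, v, (B' ++ TryC j :: B); rewrite {1}E EA -catA.
Qed.

(** The invariant speaks of the last state, the anchor condition of all prefixes, so both go through
    one induction; each step only has to treat its own event. *)
Lemma execution_inv H s :
  execution hash H s -> exec_inv H s /\ no_anchor_if_doomed H.
Proof.
elim=> {H s} [|H s e s' _ [inv noa] st].
  split; first exact: init_inv.
  (* A doomed prefix contains a read, and the initial history has none. *)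
  move=> X e Y i E [A [j [B [k [EX rv _ _ _]]]]].
  case: rv => A' [op [v [B' [EA _]]]]; move: E; rewrite EX EA.
  by case: A' {EA} => [|? [|? [|? []]]].
split; first exact: step_inv st.
move=> X f Y i; case/lastP: Y => [|Y g].
  rewrite cats1 => /rcons_inj [<- <-] dm.
  have [Ee|/eqP ne] := eqVneq (tid e) i; last by apply/negP=> /anchor_tid.
  rewrite -Ee in dm *; apply: (eff_anchor (step_effectP inv st)).
exact (inv_doomed inv dm).
  exact: doomed_occurs dm.
by rewrite -rcons_cons -rcons_cat => /rcons_inj [E _]; apply: noa E.
Qed.

End Algorithm.

Theorem theorem3 (d : Order.disp_t) (K : orderType d) (V : Type) (M : nat)
    (hash : K -> 'I_M) (H : history K V) :
  generated hash H -> legal H -> co_opaque H.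
Proof.
case=> s /execution_inv [inv noa] legalH; apply: co_opaque_serialization => //.
by move=> i; apply: phase_inv_wf (inv_phase inv i).
Qed.
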